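(* Let $\ell$ and $p$ be distinct prime numbers with $\ell\equiv p\equiv 1\bmod 4$, and assume that $p$ is a primitive root modulo $\ell$ (i.e. $p \bmod \ell$ generates $\mathbb{F}_\ell^\times$). Then for $q=p^a$ (with $a$ a positive integer) the curve $\mathcal{H}_\ell$ is maximal over $\mathbb{F}_{q^2}$ if and only if $a=b\cdot(\ell-1)/2$ with $b$ a positive odd integer.
   Context: For $d\in\mathbb{Z}_{>0}$ the $d$-th Chebyshev polynomial $\Phi_d(x)\in\mathbb{Z}[x]$ is the unique polynomial such that $\Phi_d(x+\frac1x)=x^d+\frac1{x^d}$ in $\mathbb{Z}[x,x^{-1}]$. For a prime $p$, $\varphi_d(x)\in\mathbb{F}_p[x]$ denotes the reduction of $\Phi_d(x)$ modulo $p$. For $p\nmid 2d$, $\varphi_d(x)$ is separable, and $\mathcal{H}_d$ denotes the complete, regular, absolutely irreducible (hyperelliptic) curve over $\mathbb{F}_p$ (and, by base change, over extensions of $\mathbb{F}_p$) given by the affine equation $y^2=\varphi_d(x)$; its genus is $g(\mathcal{H}_d)=\lfloor (d-1)/2\rfloor$. For $q$ a power of $p$, the curve $\mathcal{H}_d$ is called maximal over $\mathbb{F}_{q^2}$ if $\#\mathcal{H}_d(\mathbb{F}_{q^2})=q^2+1+2g(\mathcal{H}_d)q$. *)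

(* Defs.v *)
From HB Require Import structures.
From mathcomp Require Import all_boot all_order all_fingroup all_algebra.
From mathcomp Require Import all_solvable.
From mathcomp Require Import ring.

Set Implicit Arguments.
Unset Strict Implicit.
Unset Printing Implicit Defensive.

Import GRing.Theory.
Local Open Scope ring_scope.

Local Notation "x %:F" := (tofrac x).

(* The identity P(x + 1/x) = x^d + 1/x^d is stated in Frac(Z[x]), of which     *)
(* Z[x, 1/x] is a subring.                                                    *)
Definition is_chebyshev (d : nat) (P : {poly int}) : bool :=
  let x : {fraction {poly int}} := ('X : {poly int})%:F in
  (map_poly intr P).[x + x^-1] == x ^+ d + x ^- d.

Lemma fracX_neq0 : ('X : {poly int})%:F != 0 :> {fraction {poly int}}.
Proof. by rewrite tofrac_eq0 polyX_eq0. Qed.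

Lemma is_chebyshev_inj d P Q : is_chebyshev d P -> is_chebyshev d Q -> P = Q.
Proof.
move=> /eqP hP /eqP hQ; apply/eqP; rewrite -subr_eq0.
set D := P - Q; set x := ('X : {poly int})%:F in hP hQ *.
have hD : (map_poly intr D).[x + x^-1] = 0.
  by rewrite /D rmorphB hornerD hornerN hP hQ subrr.
apply/contraT => nzD; pose n := (size D).-1.
have sD : size D = n.+1 by rewrite /n prednK // lt0n size_poly_eq0.
have hx : x != 0 := fracX_neq0.
pose E : {poly int} := \sum_(i < n.+1) (D`_i)%:P * (('X ^+ 2 + 1) ^+ i * 'X ^+ (n - i)).
have E0 : E = 0.
  apply/eqP; rewrite -tofrac_eq0 rmorph_sum /=.
  have -> : \sum_(i < n.+1) ((D`_i)%:P * (('X ^+ 2 + 1) ^+ i * 'X ^+ (n - i)))%:F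
          = x ^+ n * (map_poly intr D).[x + x^-1]; last by rewrite hD mulr0.
  rewrite (@horner_coef_wide _ n.+1); last by rewrite -sD size_poly.
  rewrite mulr_sumr; apply: eq_bigr => i _.
  rewrite coef_map -[D`_i in LHS]intz !rmorph_int /= !rmorphM /= !rmorphXn /= rmorphD.
  rewrite rmorph_int rmorphXn rmorph1 /= -/x.
  have -> : x ^+ 2 + 1 = x * (x + x^-1) by rewrite mulrDr mulfV // expr2.
  have -> : x ^+ n = x ^+ i * x ^+ (n - i) by rewrite -exprD subnKC // -ltnS.
  by rewrite exprMn mulrCA -!mulrA; congr (_ * _); rewrite mulrCA [in RHS]mulrCA; congr (_ * _); exact: mulrC.
have : E.[0] = D`_n.
  rewrite horner_sum big_ord_recr /= big1 ?add0r => [|i _].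
    by rewrite subnn !hornerE /= ?expr0n /= ?add0r ?expr1n ?mulr1.
  by rewrite !hornerE /= expr0n subn_eq0 leqNgt ltn_ord !mulr0.
rewrite E0 horner0 => /esym/eqP; rewrite -[D`_n]/(lead_coef D).
by rewrite lead_coef_eq0 (negPf nzD).
Qed.

Lemma recurrence_aux (K : fieldType) (x : K) d : x != 0 ->
  (x + x^-1) * (x ^+ d.+1 + x ^- d.+1) - (x ^+ d + x ^- d) = x ^+ d.+2 + x ^- d.+2.
Proof. by move=> hx; rewrite !exprS; field; rewrite hx expf_neq0. Qed.

Lemma is_chebyshev_monic_exists d :
  exists2 P, is_chebyshev d P & (0 < d)%N -> P \is monic /\ size P = d.+1.
Proof.
suff [P [Q [hP _ [h _]]]] : exists P Q, [/\ is_chebyshev d P, is_chebyshev d.+1 Q,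
    ((0 < d)%N -> P \is monic /\ size P = d.+1) /\ (size P <= d.+1)%N,
    Q \is monic & size Q = d.+2] by exists P.
elim: d => [|d [P [Q [hP hQ [_ sP] mQ sQ]]]].
  exists 2%:R, 'X; split; rewrite ?monicX ?size_polyX //; last first.
  - by split=> //; rewrite -polyC_natr size_polyC_leq1.
  - by apply/eqP; rewrite map_polyX hornerX !expr1.
  by apply/eqP; rewrite rmorph_nat -polyC_natr hornerC expr0 invr1.
have sXQ : size ('X * Q) = d.+3 by rewrite mulrC size_mulX ?sQ // monic_neq0.
have lt : (size (- P) < size ('X * Q)%R)%N by rewrite size_polyN sXQ ltnS ltnW.
exists Q, ('X * Q - P); split.
- exact: hQ.
- apply/eqP; rewrite rmorphB rmorphM /= map_polyX hornerD hornerN hornerM hornerX.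
  rewrite (eqP hP) (eqP hQ); set x := _%:F.
  have hx : x != 0 := fracX_neq0.
  exact: recurrence_aux.
- by split=> [_|]; rewrite sQ.
- by rewrite monicE lead_coefDl // -monicE monicMl ?monicX.
- by rewrite size_polyDl.
Qed.

Lemma is_chebyshev_exists d : exists P, is_chebyshev d P.
Proof. by have [P hP _] := is_chebyshev_monic_exists d; exists P. Qed.

Definition Chebyshev (d : nat) : {poly int} := xchoose (is_chebyshev_exists d).

Lemma ChebyshevP d : is_chebyshev d (Chebyshev d).
Proof. exact: xchooseP. Qed.

Lemma Chebyshev_monic d :
  (0 < d)%N -> Chebyshev d \is monic /\ size (Chebyshev d) = d.+1.
Proof.
by have [P hP h] := is_chebyshev_monic_exists d; rewrite (is_chebyshev_inj (ChebyshevP d) hP).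
Qed.

Definition chebyshev_mod (p d : nat) : {poly 'F_p} := map_poly intr (Chebyshev d).

Section Hyperelliptic.

Variables (F : finFieldType) (f : {poly F}).

(* floor ((deg f - 1) / 2)                                                    *)
Definition hyp_genus : nat := (((size f).-1).-1)./2.

(* For f separable and 2 != 0 in F, the complete regular curve with affine    *)
(* equation y^2 = f(x) is the hypersurface Y^2 = Z^(2g+2) f(X/Z) in the       *)
(* weighted projective plane P(1, g+1, 1), with (X, Z) != (0, 0); it is the   *)
(* gluing of y^2 = f(x) and v^2 = u^(2g+2) f(1/u) along u = 1/x and           *)
(* v = y/x^(g+1). Its F-points are the F^*-orbits of solutions in F^3.        *)
Definition on_hyp_cone (P : F * F * F) : bool :=
  let: (X, Y, Z) := P in
  ((X, Z) != (0, 0)) &&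
  (Y ^+ 2 == \sum_(i < size f) f`_i * X ^+ i * Z ^+ (2 * hyp_genus + 2 - i)).

Definition weighted_orbit (P : F * F * F) : {set F * F * F} :=
  let: (X, Y, Z) := P in
  [set (c * X, c ^+ hyp_genus.+1 * Y, c * Z) | c : F & c != 0].

Definition hyp_points : {set {set F * F * F}} :=
  [set weighted_orbit P | P : F * F * F & on_hyp_cone P].

(* Meant for #|F| = q ^ 2.                                                    *)
Definition hyp_maximal (q : nat) : Prop :=
  #|hyp_points| = (q ^ 2 + 1 + 2 * hyp_genus * q)%N.

End Hyperelliptic.

Lemma hyp_genus_chebyshev (p d : nat) (F : finFieldType)
    (iota : {rmorphism 'F_p -> F}) :
  (0 < d)%N -> hyp_genus (map_poly iota (chebyshev_mod p d)) = ((d - 1) %/ 2)%N.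
Proof.
move=> /Chebyshev_monic[mP sP]; rewrite /hyp_genus size_map_poly.
by rewrite size_map_poly_id0 ?sP /= ?subn1 ?divn2 // (monicP mP) rmorph1 oner_eq0.
Qed.

Definition primitive_root_mod (p l : nat) : Prop :=
  exists2 u : {unit 'F_l}, val u = p%:R & generator [set: {unit 'F_l}] u.

(* Main.v *)
Require Import Defs.
From mathcomp Require Import all_boot all_order all_fingroup all_algebra.
From mathcomp Require Import all_solvable all_field.
From mathcomp Require Import ring zify.

(** Counting points turns the maximality of y^2 = phi_l(x) over the field with
    p^(2a) elements into an evaluation: the sum over x of the quadratic symbol
    of phi_l(x) has to be (l - 1) p^a. Put n = (l - 1) / 2.

    The polynomial phi_l is odd, phi_l(x) = x h(x^2), and since p = 1 mod 4 the
    quadratic symbol of x is a quartic symbol eta of x^2. So the sum over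
    F_{p^m} is S_m + conj(S_m), where S_m is the sum of eta(z) chi(h(z)) over z
    in F_{p^m} and chi is the quadratic symbol ([chebsum_powsum]). On the curve
    this is the splitting by the automorphism (x, y) |-> (- x, i y).

    The roots of h are the x^2 with x a nonzero root of phi_l, and phi_l
    vanishes at i (t - 1/t) for t^l = 1. As p generates the units modulo l, the
    Frobenius permutes the n roots of h cyclically: h is irreducible over F_p.
    Let Psi(f) = eta(f(0)) chi(f mod h), a Dirichlet character of F_p[X] with
    modulus X h. By a reciprocity law ([reciprocity]) its value at the
    characteristic polynomial of z in F_{p^m} is eta(z) chi(h(z)), up to a sign
    that is 1 for even m. Unique factorization in F_p[X] then relates the S_m,
    taken with these signs, to the sums c_m of Psi over the monic polynomials of
    degree m by the identities of Newton ([newton]): the L-function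
    sum_m c_m T^m is exp(sum_m S_m T^m / m). It is determined by three facts.

    - For m > n, c_m = 0, as for every nontrivial character ([moncoef_high]).
    - For 0 < m < n, l is prime to p^(2m) - 1, so the Dickson polynomial
      z h(z)^2 permutes F_{p^m} and S_m is a complete sum of eta, that is 0
      ([powsum_low]); by Newton, c_m = 0.
    - c_n = eta(h(0)) G, where G is the quadratic Gauss sum of F_{p^n}, because
      the monic polynomials of degree n are the h + r with deg r < n, and r runs
      over F_p[X]/(h) ([moncoef_n]). Now G^2 = p^n, and h(0) is not a square in
      F_p: it is the square of the product of the x^(p^t), t < n, for a nonzero
      root x of phi_l, and the Frobenius negates this product since
      x^(p^n) = - x ([hquart_sqr]). So eta(h(0)) is a primitive fourth root of
      unity and c_n^2 = - p^n.

    Hence the L-function is 1 + c_n T^n with c_n purely imaginary, S_m = 0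
    unless n divides m, and S_{kn} = (-1)^(k-1) n c_n^k. For m = 2a the sum
    S_m + conj(S_m) is 0 unless 2a = kn with k even, and then, with k = 2b and
    a = bn, it is (-1)^(b+1) (l - 1) p^a. *)

Set Implicit Arguments.
Unset Strict Implicit.
Unset Printing Implicit Defensive.

Import GRing.Theory Num.Theory.
Local Open Scope ring_scope.

(** * Sums over lists *)

(** The inequality of the sizes makes the injection [f] a bijection. *)
Lemma big_reindex_seq (V : nmodType) (T U : eqType) (s : seq T) (t : seq U)
    (f : T -> U) (E : U -> V) :
  uniq s -> uniq t -> {in s &, injective f} -> {in s, forall x, f x \in t} ->
  (size t <= size s)%N ->
  \sum_(x <- s) E (f x) = \sum_(y <- t) E y.
Proof.
move=> us ut injf st le.
rewrite -(big_map f predT E) /=; apply: perm_big.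
have um : uniq (map f s) by rewrite map_inj_in_uniq.
have sub : {subset map f s <= t} by move=> _ /mapP[x xs ->]; exact: st.
have [_ eqi] := uniq_min_size um sub ltac:(by rewrite size_map).
exact: uniq_perm.
Qed.

(** Applied to character sums: a substitution that multiplies a sum by a value
    of the character other than 1 shows that the sum vanishes. *)
Lemma fixed_by_scalar (R : idomainType) (a x : R) : a != 1 -> x = a * x -> x = 0.
Proof.
move=> a1 /eqP; rewrite -subr_eq0 -[X in X - _]mul1r -mulrBl mulf_eq0 subr_eq0 eq_sym.
by rewrite (negPf a1) => /eqP.
Qed.

(** * The finite subfields of an algebraically closed field *)

Lemma sqrt_exists (L : closedFieldType) (v : L) : exists u, u ^+ 2 = v.
Proof.
have [u ur] : exists u : L, root ('X^2 - v%:P) u.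
  by apply/closed_rootP; rewrite size_XnsubC.
by exists u; move: ur; rewrite rootE !hornerE subr_eq0 => /eqP.
Qed.

Section FiniteSubfields.

Variables (p : nat) (L : closedFieldType).
Hypothesis charL : p \in [pchar L].

Let p_pr : prime p := pcharf_prime charL.

(** The subfield with p^j elements, as the list of its elements, so that sums
    over the subfields of all degrees live in the same field [L]. *)
Definition subF j : seq L :=
  sval (closed_field_poly_normal ('X^(p ^ j) - 'X : {poly L})).

Let expp_gt1 j : (0 < j)%N -> (1 < p ^ j)%N.
Proof. by move=> j0; rewrite -(expn0 p) ltn_exp2l // prime_gt1. Qed.

Lemma size_XqsubX j : (0 < j)%N ->
  size ('X^(p ^ j) - 'X : {poly L}) = (p ^ j).+1.
Proof.
by move=> /expp_gt1 h; rewrite size_polyDl size_polyXn // size_polyN size_polyX.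
Qed.

Lemma subF_prod j : (0 < j)%N ->
  'X^(p ^ j) - 'X = \prod_(z <- subF j) ('X - z%:P) :> {poly L}.
Proof.
move=> j0; rewrite /subF; case: closed_field_poly_normal => r /= {1}->.
rewrite lead_coefDl; last by rewrite size_polyN size_polyX size_polyXn ltnS expp_gt1.
by rewrite lead_coefXn scale1r.
Qed.

Lemma mem_subF j z : (0 < j)%N -> (z \in subF j) = (z ^+ (p ^ j) == z).
Proof.
move=> j0; rewrite -root_prod_XsubC -subF_prod // rootE !hornerE.
by rewrite subr_eq0.
Qed.

Lemma size_subF j : (0 < j)%N -> size (subF j) = (p ^ j)%N.
Proof.
move=> j0; have := size_XqsubX j0.
by rewrite subF_prod // size_prod_XsubC => -[].
Qed.

Lemma subF_uniq j : (0 < j)%N -> uniq (subF j).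
Proof.
move=> j0; rewrite -separable_prod_XsubC -subF_prod //.
rewrite separable_poly.unlock derivB derivXn derivX -scaler_nat.
have -> : (p ^ j)%:R = 0 :> L.
  by apply/eqP; rewrite -(dvdn_pcharf charL) dvdn_exp.
by rewrite scale0r sub0r -[X in coprimep _ X]scaleN1r coprimepZr ?coprimep1 // oppr_eq0 oner_eq0.
Qed.

Lemma expp_inj t (x y : L) : x ^+ (p ^ t) = y ^+ (p ^ t) -> x = y.
Proof.
elim: t => [|t IH]; rewrite ?expn0 ?expr1 // expnSr !exprM => h; apply: IH.
exact: (fmorph_inj (pFrobenius_aut charL)).
Qed.

Lemma exppD t (x y : L) : (x + y) ^+ (p ^ t) = x ^+ (p ^ t) + y ^+ (p ^ t).
Proof. by apply: exprDn_pchar; rewrite pnatX pnatE ?charL. Qed.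

Lemma exppN t (x : L) : (- x) ^+ (p ^ t) = - (x ^+ (p ^ t)).
Proof. by apply/eqP; rewrite -addr_eq0 -exppD addNr expr0n expn_eq0 eqn0Ngt prime_gt0. Qed.

Lemma subF_expM j z i : (0 < j)%N -> z \in subF j -> z ^+ (p ^ (j * i)) = z.
Proof.
move=> jp; rewrite mem_subF // => /eqP zj.
by elim: i => [|i IH]; rewrite ?muln0 ?expr1 // mulnS expnD exprM zj.
Qed.

Lemma subF_expr1 j (x : L) : (0 < j)%N -> x \in subF j -> x != 0 ->
  x ^+ (p ^ j).-1 = 1.
Proof.
move=> jp; rewrite mem_subF // => /eqP xj x0; apply: (mulIf x0).
by rewrite -exprSr prednK ?expn_gt0 ?prime_gt0 // xj mul1r.
Qed.

Lemma subF_mul j : (0 < j)%N -> {in subF j &, forall x y, x * y \in subF j}.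
Proof.
by move=> jp x y; rewrite !mem_subF // => /eqP xE /eqP yE; rewrite exprMn xE yE.
Qed.

Lemma subF_add j : (0 < j)%N -> {in subF j &, forall x y, x + y \in subF j}.
Proof.
by move=> jp x y; rewrite !mem_subF // => /eqP xE /eqP yE; rewrite exppD xE yE.
Qed.

Lemma sum_subF_scale (V : nmodType) j (a : L) (E : L -> V) : (0 < j)%N -> a \in subF j ->
  a != 0 -> \sum_(x <- subF j) E (a * x) = \sum_(x <- subF j) E x.
Proof.
move=> jp aj a0; apply: big_reindex_seq; rewrite ?subF_uniq //.
  by move=> x y _ _; exact: mulfI.
by move=> x xj; exact: subF_mul.
Qed.

Lemma sum_embed (F : finFieldType) (e : {rmorphism F -> L}) (V : nmodType) (E : L -> V) m :
  (0 < m)%N -> #|F| = (p ^ m)%N -> \sum_(x : F) E (e x) = \sum_(x <- subF m) E x.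
Proof.
move=> m0 cF; rewrite -big_enum /=; apply: big_reindex_seq.
- exact: enum_uniq.
- exact: subF_uniq.
- by move=> x y _ _; exact: fmorph_inj.
- by move=> x _; rewrite mem_subF // -cF -rmorphXn expf_card.
by rewrite size_subF // -cardE cF.
Qed.

End FiniteSubfields.

(** * Conjugates and characteristic polynomials over the prime field *)

Lemma dvdp_mup (F : closedFieldType) (f g : {poly F}) : f != 0 -> g != 0 ->
  (g %| f) = all (fun x => (mup x g <= mup x f)%N) (sval (closed_field_poly_normal g)).
Proof.
move=> f0 g0; apply/idP/allP => [|le].
  case/dvdpP=> q fE x _; rewrite fE mupM ?leq_addl //.
  by apply: contraNneq f0 => q0; rewrite fE q0 mul0r.
case: (closed_field_poly_normal g) le => s gE /= le.
have [r fE] := closed_field_poly_normal f.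
have lf0 : lead_coef f != 0 by rewrite lead_coef_eq0.
have lg0 : lead_coef g != 0 by rewrite lead_coef_eq0.
have mE (x c : F) (t : seq F) : c != 0 ->
    mup x (c *: \prod_(z <- t) ('X - z%:P)) = count_mem x t.
  move=> cn0; rewrite -mul_polyC mupMr ?mu_prod_XsubC //.
  by rewrite rootC.
have cle x : (count_mem x s <= count_mem x r)%N.
  have [xs|/count_memPn -> //] := boolP (x \in s).
  by have := le x xs; rewrite {1}gE {1}fE !mE.
have [t st prt] := iffLR (count_subseqP s r) cle.
have [m sm tE] := subseqP st; rewrite {t st}tE in prt.
rewrite gE fE dvdpZl // dvdpZr // (perm_big _ prt) /=.
elim: m r {fE cle sm prt} => [|b m IH] [|y r] //=; rewrite ?mask0 ?big_nil ?dvd1p //.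
rewrite [X in _ %| X]big_cons; case: b; last by rewrite dvdp_mull.
by rewrite big_cons dvdp_mul.
Qed.

Lemma mupX (F : fieldType) (x : F) (g : {poly F}) e : g != 0 -> mup x (g ^+ e) = (e * mup x g)%N.
Proof.
move=> g0; elim: e => [|e IH]; last by rewrite exprS mupM ?expf_neq0 // IH mulSn.
by rewrite expr0 mupNroot // -polyC1 rootC oner_eq0.
Qed.

Section Conjugates.

Variables (p : nat) (L : closedFieldType).
Hypothesis charL : p \in [pchar L].
Variable (emb : {rmorphism 'F_p -> L}).

Let p_pr : prime p := pcharf_prime charL.
Local Notation "f ^^" := (map_poly emb f) (at level 2, format "f ^^").

Lemma fp_fix (a : 'F_p) t : emb a ^+ (p ^ t) = emb a.
Proof.
elim: t => [|t IH]; first by rewrite expr1.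
by rewrite expnSr exprM IH -rmorphXn -[X in a ^+ X](card_Fp p_pr) expf_card.
Qed.

Lemma fp_fix1 (a : 'F_p) : emb a ^+ p = emb a.
Proof. by have := fp_fix a 1; rewrite expn1. Qed.

Lemma fp_image (y : L) : y ^+ p = y -> exists a, emb a = y.
Proof.
move=> yp; have y1 : y \in subF p L 1 by rewrite mem_subF // expn1 yp.
have um : uniq (map emb (enum 'F_p)) by rewrite map_inj_uniq ?enum_uniq //; exact: fmorph_inj.
have [||_ E] := uniq_min_size um (s2 := subF p L 1).
- by move=> _ /mapP[a _ ->]; rewrite mem_subF // fp_fix.
- by rewrite size_map -cardE card_Fp // size_subF.
by move: y1; rewrite -E => /mapP[a _ ->]; exists a.
Qed.

Lemma fp_subF (a : 'F_p) j : (0 < j)%N -> emb a \in subF p L j.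
Proof. by move=> jp; rewrite mem_subF // fp_fix. Qed.

Definition descend (g : {poly L}) : {poly 'F_p} :=
  \poly_(i < size g) odflt 0 [pick a | emb a == g`_i].

(** The coefficients of a polynomial fixed by the Frobenius are the roots of
    X^p - X, that is, the elements of the prime field. *)
Lemma descendK (g : {poly L}) : map_poly (pFrobenius_aut charL) g = g ->
  (descend g)^^ = g.
Proof.
move=> gF; apply/polyP=> i; rewrite coef_map coef_poly /=.
case: ltnP => [_|le]; last by rewrite rmorph0 nth_default.
case: pickP => [a /eqP //|/= noa].
have [a E] : exists a, emb a = g`_i.
  by apply: fp_image; rewrite -[in RHS]gF coef_map /= pFrobenius_autE.
by have := noa a; rewrite E eqxx.
Qed.

Lemma mapFrob (f : {poly 'F_p}) : map_poly (pFrobenius_aut charL) f^^ = f^^.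
Proof.
apply/polyP=> i.
by rewrite !coef_map /= pFrobenius_autE fp_fix1.
Qed.

Lemma horner_Frob (f : {poly 'F_p}) (z : L) t : f^^.[z] ^+ (p ^ t) = f^^.[z ^+ (p ^ t)].
Proof.
elim: t => [|t IH]; first by rewrite !expr1.
rewrite expnSr !exprM IH; set y := z ^+ _.
rewrite -!(pFrobenius_autE charL) -(horner_map (pFrobenius_aut charL)) /=.
by rewrite mapFrob.
Qed.

Lemma horner_subF (f : {poly 'F_p}) (z : L) j : (0 < j)%N ->
  z \in subF p L j -> f^^.[z] \in subF p L j.
Proof. by move=> jp; rewrite !mem_subF // horner_Frob => /eqP ->. Qed.

(** The characteristic polynomial of multiplication by [z] in the field with
    p^j elements: each conjugate of [z] is repeated j / d times, where d is the
    degree of [z]. *)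
Definition conjpoly j (z : L) : {poly L} := \prod_(0 <= i < j) ('X - (z ^+ (p ^ i))%:P).

Lemma conjpoly_monic j z : conjpoly j z \is monic.
Proof. by apply: monic_prod => i _; rewrite monicXsubC. Qed.

Lemma size_conjpoly j z : size (conjpoly j z) = j.+1.
Proof. by rewrite /conjpoly size_prod_XsubC size_iota subn0. Qed.

Lemma conjpoly_Frob j z : (0 < j)%N -> z \in subF p L j ->
  map_poly (pFrobenius_aut charL) (conjpoly j z) = conjpoly j z.
Proof.
move=> jp zj; rewrite /conjpoly map_prod_XsubC /=.
under eq_bigr => i _ do rewrite pFrobenius_autE -exprM -expnSr.
case: j jp zj => // j _ zj; rewrite big_nat_recr //= [RHS]big_nat_recl //=.
by have := subF_expM charL 1 (ltn0Sn j) zj; rewrite muln1 expr1 => ->; rewrite mulrC.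
Qed.

Definition normpoly j z := descend (conjpoly j z).

Lemma normpolyK j z : (0 < j)%N -> z \in subF p L j -> (normpoly j z)^^ = conjpoly j z.
Proof. by move=> jp zj; rewrite descendK ?conjpoly_Frob. Qed.

Lemma mup_conj (f : {poly 'F_p}) z t : f != 0 ->
  mup (z ^+ (p ^ t)) f^^ = mup z f^^.
Proof.
move=> f0; have f0' : f^^ != 0 by rewrite map_poly_eq0.
elim: t => [|t IH]; first by rewrite expr1.
rewrite -IH expnSr exprM; set y := _ ^+ (p ^ t).
have E k : (k <= mup (y ^+ p) f^^)%N = (k <= mup y f^^)%N.
  rewrite !mup_geq // -[RHS](dvdp_map (pFrobenius_aut charL)) mapFrob.
  by rewrite [map_poly _ (_ ^+ k)]rmorphXn /= map_polyXsubC /= pFrobenius_autE.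
by apply/eqP; rewrite eqn_leq E leqnn -E leqnn.
Qed.

(** A root of a nonzero polynomial over the prime field has finitely many
    conjugates, so it lies in a finite subfield; the least degree [d] of such a
    subfield divides all the others. *)
Lemma period_exists (f : {poly 'F_p}) z : f != 0 -> root f^^ z ->
  exists d, [/\ (0 < d)%N, z \in subF p L d &
    forall j, (0 < j)%N -> z \in subF p L j -> (d %| j)%N].
Proof.
move=> f0 fz.
have [d dP dmin] : exists2 d, (0 < d)%N && (z ^+ (p ^ d) == z) &
    forall j, (0 < j)%N && (z ^+ (p ^ j) == z) -> (d <= j)%N.
  suff ex : exists d, (0 < d)%N && (z ^+ (p ^ d) == z).
    by exists (ex_minn ex) => [|j]; case: ex_minnP => // d _ h /h.
  pose s := [seq z ^+ (p ^ i) | i <- iota 0 (size f)].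
  have f0' : f^^ != 0 by rewrite map_poly_eq0.
  have rs : all (root f^^) s.
    apply/allP=> _ /mapP[i _ ->]; rewrite -dvdp_XsubCl XsubC_dvd // mup_conj //.
    by rewrite -XsubC_dvd // dvdp_XsubCl.
  have /(uniqPn 0) [a [b [ab]]] : ~~ uniq s.
    apply/negP=> us; have := max_poly_roots f0' rs us.
    by rewrite size_map size_iota size_map_poly ltnn.
  rewrite size_map size_iota => bs; have as_ := ltn_trans ab bs.
  rewrite !(nth_map 0%N) ?size_iota // !nth_iota // !add0n => E.
  exists (b - a)%N; rewrite subn_gt0 ab /=; apply/eqP; apply: (expp_inj charL (t := a)).
  by rewrite -exprM -expnD subnK // ltnW.
have [d0 zd] := andP dP.
exists d; rewrite mem_subF //; split=> // j jp; rewrite mem_subF // => zj.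
apply: contraT; rewrite /dvdn -lt0n => jd; have := ltn_pmod j d0.
rewrite ltnNge => /negP[]; apply: dmin; rewrite jd /=; move: zj.
have -> : (p ^ j = p ^ (d * (j %/ d)) * p ^ (j %% d))%N.
  by rewrite -expnD mulnC -divn_eq.
by rewrite exprM subF_expM ?mem_subF.
Qed.

Lemma conjpolyM d e z : (0 < d)%N -> z \in subF p L d ->
  conjpoly (d * e) z = conjpoly d z ^+ e.
Proof.
move=> d0 zd; elim: e => [|e IH]; first by rewrite muln0 /conjpoly big_geq.
rewrite mulnS exprS -IH {1}/conjpoly (big_cat_nat (n := d)) ?leq_addr //=.
congr (_ * _); rewrite -{1}[d]add0n big_addn addKn.
by apply: eq_bigr => i _; rewrite addnC expnD exprM -[d]muln1 subF_expM.
Qed.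

Lemma conj_uniq d z : (0 < d)%N ->
  (forall j, (0 < j)%N -> z \in subF p L j -> (d %| j)%N) ->
  uniq [seq z ^+ (p ^ i) | i <- index_iota 0 d].
Proof.
move=> d0 dmin; rewrite map_inj_in_uniq ?iota_uniq // => i j.
rewrite !mem_index_iota /=.
wlog lij : i j / (i <= j)%N => [H id jd E|_ jd E].
  by case/orP: (leq_total i j) => ?; [|symmetry]; apply: H.
apply/eqP; rewrite eqn_leq lij /= -subn_eq0; apply: contraT; rewrite -lt0n => ji.
have /(dvdn_leq ji) : (d %| j - i)%N; last first.
  by rewrite leqNgt (leq_ltn_trans (leq_subr i j) jd).
apply: dmin; rewrite // mem_subF //; apply/eqP/(expp_inj charL (t := i)).
by rewrite -exprM -expnD subnK.
Qed.

(** All conjugates of [z] have the same multiplicity in [f], and each of them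
    has multiplicity [e] in the characteristic polynomial of degree d e. *)
Lemma dvdp_conjpoly (f : {poly 'F_p}) d e z : f != 0 -> (0 < d)%N -> z \in subF p L d ->
  (forall j, (0 < j)%N -> z \in subF p L j -> (d %| j)%N) ->
  (conjpoly (d * e) z %| f^^) = (e <= mup z f^^)%N.
Proof.
move=> f0 d0 zd dmin; have f0' : f^^ != 0 by rewrite map_poly_eq0.
pose s := [seq z ^+ (p ^ i) | i <- index_iota 0 d].
have us : uniq s by exact: conj_uniq.
have mE x : mup x (conjpoly (d * e) z) = (e * (x \in s))%N.
  rewrite conjpolyM // mupX ?monic_neq0 ?conjpoly_monic //; congr (_ * _)%N.
  by rewrite -(count_uniq_mem _ us) -mu_prod_XsubC big_map.
have cn0 : conjpoly (d * e) z != 0 by rewrite monic_neq0 ?conjpoly_monic.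
rewrite dvdp_mup //; apply/allP/idP => [|le x _].
  case: (posnP e) => [-> //|e0].
  have zs : z \in s by apply/mapP; exists 0%N; rewrite ?mem_index_iota ?expr1.
  move/(_ z); rewrite mE zs muln1; apply.
  rewrite -root_prod_XsubC; case: closed_field_poly_normal => r /= E.
  have := E; rewrite (monicP (conjpoly_monic _ _)) scale1r => <-.
  rewrite -dvdp_XsubCl XsubC_dvd //.
  by rewrite mE zs muln1.
rewrite mE; have [/mapP[i _ ->]|_] := boolP (x \in s); last by rewrite muln0.
by rewrite muln1 mup_conj.
Qed.

(** The weight deg f = sum_{P^e | f} deg P of unique factorization, read on roots
    instead of irreducible factors: a root [z] of degree d and multiplicity mu
    is counted once for each of the degrees d, 2 d, ..., mu d. *)
Lemma sum_conjpoly_dvd (f : {poly 'F_p}) m : f \is monic -> size f = m.+1 ->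
  (\sum_(1 <= j < m.+1) \sum_(z <- subF p L j) (conjpoly j z %| f^^)%R = m)%N.
Proof.
move=> fm sf; have f0 : f != 0 by exact: monic_neq0.
have f0' : f^^ != 0 by rewrite map_poly_eq0.
have [r fE] := closed_field_poly_normal f^^.
rewrite lead_coef_map (monicP fm) rmorph1 scale1r in fE.
have sr : size r = m.
  by have := size_map_poly emb f; rewrite fE size_prod_XsubC sf => -[].
(* Only roots of f contribute, as z is a root of its characteristic polynomial. *)
have inner j : (0 < j)%N -> (\sum_(z <- subF p L j) (conjpoly j z %| f^^)%R =
    \sum_(z <- undup r) ((z \in subF p L j) && (conjpoly j z %| f^^)%R))%N.
  move=> jp.
  transitivity (\sum_(z <- subF p L j | (conjpoly j z %| f^^)%R) 1)%N.
    by rewrite [RHS]big_mkcond; apply: eq_bigr => z _; case: (_ %| _).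
  transitivity (\sum_(z <- undup r | (z \in subF p L j) && (conjpoly j z %| f^^)%R) 1)%N; last first.
    by rewrite [LHS]big_mkcond; apply: eq_bigr => z _; case: (_ && _).
  rewrite -big_filter -[RHS]big_filter; apply: perm_big; apply: uniq_perm.
  - by rewrite filter_uniq // subF_uniq.
  - by rewrite filter_uniq // undup_uniq.
  move=> z; rewrite !mem_filter mem_undup [in RHS]andbC andbA [LHS]andbC.
  case: (boolP (z \in subF _ _ _)) => zj; rewrite /= ?andbF ?andbT //.
  apply/idP/andP => [h|[] //]; split=> //.
  rewrite -root_prod_XsubC -fE -dvdp_XsubCl; apply: dvdp_trans h.
  by rewrite /conjpoly big_ltn // expr1 dvdp_mulr.
rewrite big_nat (eq_bigr _ (fun j (h : (1 <= j < m.+1)%N) => inner j (proj1 (andP h)))) -big_nat.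
rewrite exchange_big /=.
rewrite -[RHS]sr -[RHS]sum1_size -[RHS]big_undup_iterop_count /=.
rewrite big_seq [RHS]big_seq; apply: eq_bigr => z; rewrite mem_undup => zr.
have fz : root f^^ z by rewrite fE root_prod_XsubC.
have [d [d0 zd dmin]] := period_exists f0 fz.
have cE : count_mem z r = mup z f^^ by rewrite fE mu_prod_XsubC.
rewrite cE; set mu := mup z f^^.
have lem : (d * mu <= m)%N.
  have : conjpoly (d * mu) z %| f^^ by rewrite dvdp_conjpoly.
  by move/(dvdp_leq f0'); rewrite size_conjpoly size_map_poly sf ltnS.
have -> : iterop mu addn 1%N 0%N = mu by rewrite Monoid.iteropE iter_addn_0 mul1n.
transitivity (\sum_(1 <= j < m.+1 | (d %| j) && (j %/ d <= mu)) 1)%N.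
  rewrite [RHS]big_mkcond /=; apply: eq_big_nat => j /andP[j1 jm].
  case: (boolP (z \in _)) => zj /=; last first.
    case: (boolP (d %| j)%N) => dj //=; case/negP: zj.
    by rewrite mem_subF // -{1}(divnK dj) mulnC subF_expM.
  by have dj := dmin _ j1 zj; rewrite dj /= -{1}(divnK dj) mulnC dvdp_conjpoly //.
rewrite -big_filter sum1_size -[RHS](size_iota 1) -[RHS](size_map (muln d)).
apply: perm_size; apply: uniq_perm.
- by rewrite filter_uniq // iota_uniq.
- by rewrite map_inj_uniq ?iota_uniq // => a b /eqP; rewrite eqn_pmul2l // => /eqP.
move=> j; rewrite mem_filter mem_index_iota; apply/idP/mapP => [|[e]].
  case/andP=> /andP[dj le] /andP[j1 _]; exists (j %/ d)%N; last by rewrite mulnC divnK.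
  by rewrite mem_iota add1n ltnS le andbT divn_gt0 // dvdn_leq.
rewrite mem_iota add1n ltnS => /andP[e1 le] ->.
rewrite dvdn_mulr // mulKn // le /= muln_gt0 d0 e1 ltnS /=.
by apply: leq_trans lem; rewrite leq_mul2l le orbT.
Qed.

End Conjugates.

(** * Newton identities for completely multiplicative functions *)

Section PolynomialLists.

Variable k : finFieldType.

Definition polys_lt m : seq {poly k} := [seq polyn r | r <- enum {poly_m k}].

Lemma mem_polys_lt m g : (g \in polys_lt m) = (size g <= m)%N.
Proof.
apply/mapP/idP => [[r _ ->]|sg]; first exact: size_npoly.
by exists (npolyp m g); rewrite ?mem_enum // npolypK.
Qed.

Lemma polys_lt_uniq m : uniq (polys_lt m).
Proof. by rewrite map_inj_uniq ?enum_uniq //; exact: val_inj. Qed.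

Lemma size_polys_lt m : size (polys_lt m) = (#|k| ^ m)%N.
Proof. by rewrite size_map -cardE card_npoly. Qed.

Definition monic_polys m : seq {poly k} := [seq 'X^m + g | g <- polys_lt m].

Lemma mem_monic_polys m f : (f \in monic_polys m) = (f \is monic) && (size f == m.+1).
Proof.
apply/mapP/andP => [[g]|[fm /eqP sf]]; rewrite ?mem_polys_lt.
  move=> sg ->; have lt : (size g < size ('X^m : {poly k}))%N by rewrite size_polyXn ltnS.
  by rewrite monicE lead_coefDl // lead_coefXn size_polyDl // size_polyXn.
exists (f - 'X^m); last by rewrite addrC subrK.
rewrite mem_polys_lt; apply/leq_sizeP=> j; rewrite leq_eqVlt coefB coefXn.
case/orP=> [/eqP <-|lt]; last by rewrite nth_default ?sf // gtn_eqF // subr0.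
by have := monicP fm; rewrite lead_coefE sf /= => ->; rewrite eqxx subrr.
Qed.

Lemma monic_polys_uniq m : uniq (monic_polys m).
Proof. by rewrite map_inj_uniq ?polys_lt_uniq //; exact: addrI. Qed.

Lemma size_monic_polys m : size (monic_polys m) = (#|k| ^ m)%N.
Proof. by rewrite size_map size_polys_lt. Qed.

Lemma sum_monic_multiples (V : nmodType) (E : {poly k} -> V) (N : {poly k}) j m :
  N \is monic -> size N = j.+1 -> (j <= m)%N ->
  \sum_(f <- monic_polys m | N %| f) E f = \sum_(g <- monic_polys (m - j)) E (N * g).
Proof.
move=> Nm sN jm; rewrite -big_filter; apply/esym.
have N0 := monic_neq0 Nm.
rewrite -(big_map _ predT E); apply: perm_big; apply: uniq_perm.
- by rewrite map_inj_uniq ?monic_polys_uniq //; exact: mulfI.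
- by rewrite filter_uniq ?monic_polys_uniq.
move=> f; rewrite mem_filter mem_monic_polys; apply/mapP/idP => [[g]|].
  rewrite mem_monic_polys => /andP[gm /eqP sg] ->.
  rewrite dvdp_mulr //= monicMl // gm size_mul ?monic_neq0 // sN sg /=.
  by rewrite addnS /= subnKC.
case/and3P=> /dvdpP[g fE] fm /eqP sf; exists g; last by rewrite mulrC.
have gm : g \is monic by rewrite -(monicMr _ Nm) -fE.
rewrite mem_monic_polys gm /=; move: sf.
by rewrite fE size_mul ?monic_neq0 // sN addnS /= => sE; rewrite -subSn // -sE addnK.
Qed.

End PolynomialLists.

Section Newton.

Variables (p : nat) (L : closedFieldType).
Hypothesis charL : p \in [pchar L].
Variable (emb : {rmorphism 'F_p -> L}).
Variables (R : pzRingType) (Psi : {poly 'F_p} -> R).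
Hypothesis PsiM : forall f g, Psi (f * g) = Psi f * Psi g.

(** For the L-function [sum_m moncoef m T^m], the coefficients of
    T L'(T) / L(T). *)
Definition powsum j : R := \sum_(z <- subF p L j) Psi (normpoly emb j z).

Definition moncoef m : R := \sum_(f <- monic_polys 'F_p m) Psi f.

(** Weigh each monic [f] of degree [m] by its degree, expand the degree over the
    characteristic polynomials dividing [f] ([sum_conjpoly_dvd]), and exchange
    the sums: what remains for a divisor N of degree j is
    [Psi N] times the sum of [Psi] over the cofactors. *)
Lemma newton m :
  m%:R * moncoef m = \sum_(1 <= j < m.+1) powsum j * moncoef (m - j).
Proof.
transitivity (\sum_(1 <= j < m.+1) \sum_(z <- subF p L j)
    \sum_(f <- monic_polys 'F_p m | normpoly emb j z %| f) Psi f); last first.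
  rewrite !big_nat; apply: eq_bigr => j /andP[j1 jm].
  rewrite /powsum mulr_suml big_seq [RHS]big_seq; apply: eq_bigr => z zj.
  have nK := normpolyK charL emb j1 zj.
  rewrite (@sum_monic_multiples _ _ _ _ j) //.
  - by rewrite mulr_sumr; apply: eq_bigr => g _; rewrite PsiM.
  - by rewrite -(map_monic emb) nK conjpoly_monic.
  by rewrite -(size_map_poly emb) nK size_conjpoly.
rewrite /moncoef mulr_sumr.
under [RHS]eq_bigr => j _.
  under eq_bigr => z _ do rewrite big_mkcond.
  rewrite exchange_big; over.
rewrite exchange_big /= big_seq [RHS]big_seq; apply: eq_bigr => f.
rewrite mem_monic_polys => /andP[fm /eqP sf].
rewrite -{1}(sum_conjpoly_dvd charL emb fm sf) natr_sum mulr_suml.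
rewrite !big_nat; apply: eq_bigr => j /andP[j1 jm].
rewrite natr_sum mulr_suml big_seq [RHS]big_seq; apply: eq_bigr => z zj.
rewrite -(dvdp_map emb) (normpolyK charL emb j1 zj).
by case: (_ %| _); rewrite ?mul1r ?mul0r.
Qed.

End Newton.

Section Recurrence.

Variables (p : nat) (L : closedFieldType).
Hypothesis charL : p \in [pchar L].
Variable (emb : {rmorphism 'F_p -> L}).
Variables (R : numDomainType) (Psi : {poly 'F_p} -> R).
Hypothesis PsiM : forall f g, Psi (f * g) = Psi f * Psi g.

Local Notation powsum := (powsum emb Psi).
Local Notation moncoef := (moncoef Psi).

(** The hypotheses force the L-function to be 1 + c T^n with c = [moncoef n]. *)
Lemma powsum_recurrence n : (0 < n)%N ->
  (forall m, (n < m)%N -> moncoef m = 0) ->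
  (forall j, (0 < j < n)%N -> powsum j = 0) ->
  moncoef 0 = 1 ->
  [/\ powsum n = n%:R * moncoef n &
    forall m, (n < m)%N -> powsum m = - (powsum (m - n) * moncoef n)].
Proof.
move=> n0 c_hi s_lo c_0.
have newton := newton charL emb PsiM.
have c_lo m : (0 < m < n)%N -> moncoef m = 0.
  case/andP=> m0 mn; have := newton m; rewrite big_nat big1 => [/eqP|j jm].
    by rewrite mulf_eq0 pnatr_eq0 eqn0Ngt m0 => /eqP.
  by rewrite s_lo ?mul0r //; lia.
split=> [|m nm].
  rewrite newton (big_nat_recr n) //= subnn c_0 mulr1 big_nat big1 ?add0r // => j jn.
  by rewrite s_lo // mul0r.
have m0 : (0 < m)%N by lia.
have := newton m; rewrite c_hi // mulr0 (big_nat_recr m) //= subnn c_0 mulr1.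
rewrite (bigD1_seq (m - n)%N) ?iota_uniq ?mem_index_iota //=; last by lia.
rewrite big_nat_cond big1 ?addr0; last first.
  move=> j /andP[/andP[j1 jm] jne]; have [mjn|mjn|mjn] := ltngtP (m - j) n.
  - by rewrite c_lo ?mulr0 //; lia.
  - by rewrite c_hi ?mulr0 //; lia.
  by case/eqP: jne; lia.
by rewrite subKn ?(ltnW nm) // => /esym/eqP; rewrite addrC addr_eq0 => /eqP.
Qed.

End Recurrence.

(** * Quadratic Gauss sums and quartic symbols *)

Section QuadraticGaussSum.

Variables (K : fieldType) (R : comPzRingType) (s : seq K).
Variables (chi lam : K -> R).
Hypotheses (s_uniq : uniq s) (sN1 : -1 \in s).
Hypothesis sD : {in s &, forall x y, x + y \in s}.
Hypothesis sM : {in s &, forall x y, x * y \in s}.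
Hypothesis chi0 : chi 0 = 0.
Hypothesis chiM : {in s &, {morph chi : x y / x * y}}.
Hypothesis chi_sqr : {in s, forall x, x != 0 -> chi x ^+ 2 = 1}.
Hypothesis chi_sum : \sum_(x <- s) chi x = 0.
Hypothesis lam0 : lam 0 = 1.
Hypothesis lamD : {in s &, forall x y, lam (x + y) = lam x * lam y}.
Hypothesis lam_sum : \sum_(x <- s) lam x = 0.

Let sum_scale (a : K) (E : K -> R) : a \in s -> a != 0 ->
  \sum_(x <- s) E (a * x) = \sum_(x <- s) E x.
Proof.
move=> sa a0; apply: big_reindex_seq => // [x y _ _|x sx]; first exact: mulfI.
exact: sM.
Qed.

(** In the square of the sum, substitute y = x u in the inner sum: the symbols
    of x cancel, and summing the additive character over x leaves only
    u = -1. *)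
Lemma gauss_sum_sqr : (\sum_(x <- s) chi x * lam x) ^+ 2 = chi (-1) * (size s)%:R.
Proof.
have s1 : 1 \in s by have := sM sN1 sN1; rewrite mulrNN mulr1.
have step x : x \in s -> chi x * lam x * (\sum_(y <- s) chi y * lam y) =
    (\sum_(u <- s) chi u * lam (x * (1 + u))) - (x == 0)%:R * \sum_(u <- s) chi u.
  move=> sx; case: (eqVneq x 0) => [->|x0].
    rewrite chi0 !mul0r mul1r; apply/esym/eqP; rewrite subr_eq0; apply/eqP.
    by apply: eq_bigr => u _; rewrite mul0r lam0 mulr1.
  rewrite mul0r subr0 -(sum_scale _ sx x0) mulr_sumr.
  rewrite big_seq [RHS]big_seq; apply: eq_bigr => u su.
  rewrite chiM // mulrDr mulr1 lamD ?sM //.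
  have := chi_sqr sx x0; set a := chi x; set b := chi u.
  set c := lam x; set d := lam _ => a2.
  by rewrite -[RHS]mul1r -a2; ring.
rewrite expr2 {1}mulr_suml big_seq.
under eq_bigr => x sx do rewrite (step x sx) chi_sum mulr0 subr0.
rewrite -big_seq exchange_big /=.
have lsum v : v \in s -> \sum_(x <- s) lam (x * v) = (v == 0)%:R * (size s)%:R.
  move=> sv; case: (eqVneq v 0) => [->|v0].
    under eq_bigr => x _ do rewrite mulr0 lam0.
    by rewrite mul1r big_const_seq count_predT iter_addr addr0.
  under eq_bigr => x _ do rewrite mulrC.
  by rewrite (sum_scale lam) // lam_sum mul0r.
rewrite big_seq.
under eq_bigr => u su do rewrite -mulr_sumr lsum ?sD //.
rewrite -big_seq (bigD1_seq (-1)) //= subrr eqxx mul1r big1 ?addr0 // => u uN1.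
by rewrite addrC addr_eq0 (negPf uN1) mul0r mulr0.
Qed.

End QuadraticGaussSum.

Section QuarticSymbol.

Variables (K : fieldType) (i : K).
Hypotheses (i2 : i ^+ 2 = -1) (two0 : 2%:R != 0 :> K).

(** The isomorphism from the fourth roots of unity of [K] to those of [algC]
    that sends [i] to the complex ['i], extended by 0. *)
Definition mu4 (t : K) : algC :=
  if t == 0 then 0 else if t == 1 then 1 else if t == -1 then -1
  else if t == i then 'i else - 'i.

Definition in_mu4 (t : K) : Prop := t = 0 \/ t ^+ 4 = 1.

Lemma neg1_neq1 : -1 != 1 :> K.
Proof. by rewrite -subr_eq0 -opprD oppr_eq0. Qed.

Lemma i_neq1 : i != 1.
Proof. by apply: contraNneq neg1_neq1 => E; rewrite -i2 E expr1n. Qed.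

Lemma i_neqN1 : i != -1.
Proof. by apply: contraNneq neg1_neq1 => E; rewrite -i2 E sqrrN expr1n. Qed.

Lemma i_neq0 : i != 0.
Proof. by rewrite -sqrf_eq0 i2 oppr_eq0 oner_eq0. Qed.

Lemma mu4_0 : mu4 0 = 0. Proof. by rewrite /mu4 eqxx. Qed.
Lemma mu4_1 : mu4 1 = 1. Proof. by rewrite /mu4 oner_eq0 eqxx. Qed.

Lemma mu4_N1 : mu4 (-1) = -1.
Proof. by rewrite /mu4 oppr_eq0 oner_eq0 (negPf neg1_neq1) eqxx. Qed.

Lemma mu4_i : mu4 i = 'i.
Proof. by rewrite /mu4 (negPf i_neq0) (negPf i_neq1) (negPf i_neqN1) eqxx. Qed.

Lemma mu4_Ni : mu4 (- i) = - 'i.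
Proof.
rewrite /mu4 oppr_eq0 (negPf i_neq0) eqr_oppLR (negPf i_neqN1) eqr_opp (negPf i_neq1).
rewrite -subr_eq0 -opprD oppr_eq0 -mulr2n -mulr_natr mulf_eq0.
by rewrite (negPf i_neq0) (negPf two0).
Qed.

Lemma in_mu4P t : in_mu4 t -> [\/ t = 0, t = 1, t = -1 | t = i] \/ t = - i.
Proof.
case=> [->|t4]; first by left; constructor.
have /eqP : (t - 1) * (t + 1) * ((t - i) * (t + i)) = 0.
  have -> : (t - 1) * (t + 1) * ((t - i) * (t + i)) = (t ^+ 2 - 1) * (t ^+ 2 - i ^+ 2) by ring.
  by rewrite i2 opprK; have -> : (t ^+ 2 - 1) * (t ^+ 2 + 1) = t ^+ 4 - 1 by [ring]; rewrite t4 subrr.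
rewrite !mulf_eq0 !subr_eq0 !addr_eq0 -orbA => /or4P[] /eqP ->.
- by left; constructor 2.
- by left; constructor 3.
- by left; constructor 4.
by right.
Qed.

Lemma mu4M x y : in_mu4 x -> in_mu4 y -> mu4 (x * y) = mu4 x * mu4 y.
Proof.
have ii : i * i = -1 by rewrite -expr2.
have II : 'i * 'i = -1 :> algC by rewrite -expr2 sqrCi.
move=> /in_mu4P[[]|] -> /in_mu4P[[]|] ->;
  rewrite ?(mulr0, mul0r, mulr1, mul1r, mulrN1, mulN1r, mulrN, mulNr, opprK, ii);
  rewrite ?(mu4_0, mu4_1, mu4_N1, mu4_i, mu4_Ni);
  by rewrite ?(mulr0, mul0r, mulr1, mul1r, mulrN1, mulN1r, mulrN, mulNr, opprK, II).
Qed.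

Lemma in_mu4M x y : in_mu4 x -> in_mu4 y -> in_mu4 (x * y).
Proof.
case=> [->|x4]; first by left; rewrite mul0r.
by case=> [->|y4]; [left; rewrite mulr0 | right; rewrite exprMn x4 y4 mulr1].
Qed.

Lemma in_mu4X x n : in_mu4 x -> in_mu4 (x ^+ n).
Proof.
move=> hx; elim: n => [|n IH]; first by right; rewrite !expr1n.
by rewrite exprS; apply: in_mu4M.
Qed.

Lemma mu4X x n : in_mu4 x -> mu4 (x ^+ n) = mu4 x ^+ n.
Proof.
move=> hx; elim: n => [|n IH]; first by rewrite !expr0 mu4_1.
by rewrite !exprS mu4M ?IH //; exact: in_mu4X.
Qed.

Lemma mu4_conj x : in_mu4 x -> (mu4 x)^* = mu4 x ^+ 3.
Proof.
have I3 : 'i ^+ 3 = - 'i :> algC by rewrite exprS sqrCi mulrN1.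
case/in_mu4P=> [[]|] ->; rewrite ?(mu4_0, mu4_1, mu4_N1, mu4_i, mu4_Ni).
- by rewrite conjC0 expr0n.
- by rewrite conjC1 expr1n.
- by rewrite rmorphN rmorph1 !exprS expr0; ring.
- by rewrite conjCi I3.
by rewrite rmorphN /= conjCi exprNn I3 !exprS expr0; ring.
Qed.

Lemma sqrtCi_neq1 : 'i != 1 :> algC.
Proof.
apply/eqP=> I1; have := sqrCi algC; rewrite I1 expr1n => /eqP.
by rewrite eq_sym -subr_eq0 -opprD oppr_eq0 (pnatr_eq0 _ 2).
Qed.

Lemma mu4_eq1 t : in_mu4 t -> mu4 t = 1 -> t = 1.
Proof.
have N1 : -1 != 1 :> algC by rewrite -subr_eq0 -opprD oppr_eq0 (pnatr_eq0 _ 2).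
have NI : - 'i != 1 :> algC.
  apply/eqP=> I1; have := sqrCi algC; rewrite -sqrrN I1 expr1n => /esym/eqP.
  by rewrite (negPf N1).
case/in_mu4P=> [[]|] -> //.
- by rewrite mu4_0 => /esym/eqP; rewrite oner_eq0.
- by rewrite mu4_N1 => /eqP; rewrite (negPf N1).
- by rewrite mu4_i => /eqP; rewrite (negPf sqrtCi_neq1).
by rewrite mu4_Ni => /eqP; rewrite (negPf NI).
Qed.

End QuarticSymbol.

(** * Chebyshev polynomials and primitive roots *)

Local Notation "x %:F" := (tofrac x).

(** The defining identity lives in the fraction field of Z[X]; as no morphism
    goes from there to [K], it is transported by the three-term recurrence and
    the uniqueness of the Chebyshev polynomial. *)
Lemma chebyshev_eval (K : fieldType) (u : K) d : u != 0 ->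
  (map_poly intr (Chebyshev d)).[u + u^-1] = u ^+ d + u ^- d.
Proof.
move=> u0; suff [P [Q [hP _ eP _]]] : exists P Q, [/\ is_chebyshev d P,
    is_chebyshev d.+1 Q,
    (map_poly intr P).[u + u^-1] = u ^+ d + u ^- d &
    (map_poly intr Q).[u + u^-1] = u ^+ d.+1 + u ^- d.+1].
  by rewrite (is_chebyshev_inj (ChebyshevP d) hP).
elim: d => [|d [P [Q [hP hQ eP eQ]]]].
  exists 2%:R, 'X; split.
  - by apply/eqP; rewrite rmorph_nat -polyC_natr hornerC expr0 invr1.
  - by apply/eqP; rewrite map_polyX hornerX !expr1.
  - by rewrite rmorph_nat -polyC_natr hornerC expr0 invr1.
  by rewrite map_polyX hornerX !expr1.
exists Q, ('X * Q - P); split; [exact: hQ | | exact: eQ |].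
  apply/eqP; rewrite rmorphB rmorphM /= map_polyX hornerD hornerN hornerM hornerX.
  rewrite (eqP hP) (eqP hQ); set x := _%:F.
  have hx : x != 0 := fracX_neq0.
  exact: recurrence_aux.
rewrite rmorphB rmorphM /= map_polyX hornerD hornerN hornerM hornerX eP eQ.
exact: recurrence_aux.
Qed.

Lemma primitive_root_modP p l : (0 < p)%N -> prime l -> primitive_root_mod p l ->
  forall t, (p ^ t == 1 %[mod l]) = (l.-1 %| t)%N.
Proof.
move=> p_gt0 l_pr [u uE gen] t.
have ou : #[u]%g = l.-1.
  have := gen; rewrite /generator => /eqP gE.
  by rewrite orderE -gE card_finField_unit card_Fp.
rewrite -ou order_dvdn -(inj_eq val_inj) /= FinRing.val_unitX uE.
have p_gt0' : (0 < p ^ t)%N by rewrite expn_gt0 p_gt0.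
rewrite eqn_mod_dvd // (dvdn_pcharf (pchar_Fp l_pr)) natrB // natrX.
by rewrite subr_eq0.
Qed.

(** * The roots of the Chebyshev polynomial *)

Section LFunction.

Variables (p l : nat) (L : closedFieldType).
Hypothesis charL : p \in [pchar L].
Variable (emb : {rmorphism 'F_p -> L}).
Hypotheses (l_pr : prime l) (l_neq_p : l <> p).
Hypotheses (l_mod4 : l = 1 %[mod 4]) (p_mod4 : p = 1 %[mod 4]).
Hypothesis p_prim : forall t, (p ^ t == 1 %[mod l]) = (l.-1 %| t)%N.

Let p_pr : prime p := pcharf_prime charL.
Let n := (l.-1)./2.

Lemma l_eq : l = n.*2.+1.
Proof.
rewrite /n; have := prime_gt0 l_pr; move: l_mod4; lia.
Qed.

Lemma n_gt1 : (1 < n)%N.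
Proof. by have := prime_gt1 l_pr; have := l_eq; move: l_mod4; rewrite -/n; lia. Qed.

Lemma n_even : ~~ odd n.
Proof. by have := l_eq; move: l_mod4; lia. Qed.

Lemma two_neq0 : 2%:R != 0 :> L.
Proof.
rewrite -(dvdn_pcharf charL); apply/negP=> /(dvdn_leq (ltn0Sn 1)).
by have := prime_gt1 p_pr; move: p_mod4; lia.
Qed.

Lemma ndvd_l t : ~~ (l.-1 %| t)%N -> ~~ (l %| p ^ t - 1)%N.
Proof. by rewrite -p_prim eqn_mod_dvd // expn_gt0 prime_gt0. Qed.

(** Modulo l, p^n is a square root of 1 other than 1. *)
Lemma dvd_l_pn1 : (l %| (p ^ n).+1)%N.
Proof.
have : (l %| p ^ (l.-1) - 1)%N.
  by rewrite -eqn_mod_dvd ?p_prim // expn_gt0 prime_gt0.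
have -> : (p ^ l.-1 - 1 = (p ^ n - 1) * (p ^ n).+1)%N.
  rewrite {1}l_eq /= -addnn expnD; have : (0 < p ^ n)%N by rewrite expn_gt0 prime_gt0.
  nia.
rewrite Euclid_dvdM // => /orP[|//]; apply: contraTT => _; apply: ndvd_l.
have := n_gt1; have := l_eq => e n1; apply/negP=> /(dvdn_leq (ltnW n1)).
lia.
Qed.

(** At 1 the polynomial 1 + X + ... + X^(l-1) takes the value l, which is not 0 in
    characteristic p; so its roots have order l. *)
Lemma theta_exists : exists theta : L, l.-primitive_root theta.
Proof.
pose f : {poly L} := \sum_(k < l) 'X^k.
have sf : size f != 1%N.
  have -> : f = \poly_(k < l) 1 by rewrite poly_def; apply: eq_bigr => k _; rewrite scale1r.
  rewrite size_poly_eq ?oner_eq0 //.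
  by have := prime_gt1 l_pr; case: (l) => [|[]].
have [z fz] := closed_rootP _ sf.
have zl : z ^+ l = 1.
  apply/eqP; rewrite -subr_eq0 -[X in _ - X](expr1n _ l) subrXX.
  move: fz; rewrite rootE horner_sum => /eqP h.
  rewrite [X in _ * X](_ : _ = 0) ?mulr0 // -[RHS]h.
  rewrite [LHS](reindex_inj rev_ord_inj) /=; apply: eq_bigr => k _.
  rewrite expr1n mulr1 hornerXn; congr (z ^+ _) => /=; have := ltn_ord k; lia.
have [m zm ml] := prim_order_exists (prime_gt0 l_pr) zl.
exists z; have [/eqP m1|/eqP <- //] := orP ((primeP l_pr).2 m ml).
have z1 : z = 1 by have := prim_expr_order zm; rewrite m1 expr1.
move: fz; rewrite z1 rootE horner_sum.
under eq_bigr => k _ do rewrite hornerXn expr1n.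
rewrite sumr_const card_ord -(dvdn_pcharf charL).
by rewrite dvdn_prime2 // => /eqP E; case: l_neq_p.
Qed.

Variables (theta i : L).
Hypotheses (thetaP : l.-primitive_root theta) (i2 : i ^+ 2 = -1).

Let th0 : theta != 0.
Proof.
apply: contraTneq (oner_neq0 L) => E; have := prim_expr_order thetaP.
by rewrite E expr0n eqn0Ngt prime_gt0 //= => /esym/eqP; rewrite eq_sym => ->.
Qed.

Let i0 : i != 0.
Proof. exact: i_neq0 i2. Qed.

Lemma i_pX t : i ^+ (p ^ t) = i.
Proof.
elim: t => [|t IH]; first by rewrite expr1.
rewrite expnSr exprM IH (divn_eq p 4) p_mod4 exprD mulnC exprM.
by rewrite (exprM i 2 2) i2 sqrrN !expr1n mul1r.
Qed.

(** The number u + 1/u for u = i theta. As u^l + u^(-l) = 0, it is a root of the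
    Chebyshev polynomial, and its conjugates are all the nonzero roots. *)
Definition xi := i * (theta - theta^-1).

Lemma xi_pX t : xi ^+ (p ^ t) = i * (theta ^+ (p ^ t) - theta ^- (p ^ t)).
Proof. by rewrite exprMn i_pX (exppD charL) (exppN charL) exprVn. Qed.

Lemma xi_half : xi ^+ (p ^ n) = - xi.
Proof.
rewrite xi_pX.
have E : theta ^+ (p ^ n) = theta^-1.
  apply: (mulfI th0); rewrite -exprS mulfV //; apply/eqP.
  by rewrite -(prim_order_dvd thetaP) dvd_l_pn1.
by rewrite E invrK -mulrN opprB.
Qed.

Lemma xi_neq0 : xi != 0.
Proof.
rewrite mulf_neq0 // subr_eq0; apply/eqP=> E.
have : theta ^+ 2 == 1 by rewrite expr2 {2}E mulfV.
rewrite -(prim_order_dvd thetaP) => /(dvdn_leq (ltn0Sn 1)).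
by have := l_eq; have := n_gt1; lia.
Qed.

(** The equation xi^(p^t) = xi says that theta^(p^t) is theta or - 1 / theta; the
    order of theta being odd excludes the latter. *)
Lemma xi_period t : xi ^+ (p ^ t) = xi -> (l.-1 %| t)%N.
Proof.
rewrite xi_pX /xi => /(mulfI i0); set a := theta ^+ _ => E.
have a0 : a != 0 by rewrite expf_neq0.
have /eqP : (a - theta) * (a * theta + 1) = 0.
  have : (a - a^-1 - (theta - theta^-1)) * (a * theta) = 0 by rewrite E subrr mul0r.
  move=> <-; field; exact/andP.
rewrite mulf_eq0 subr_eq0 => /orP[/eqP aE|]; last first.
  rewrite addr_eq0 => /eqP h; have : (a * theta) ^+ l = (-1) ^+ l by rewrite h.
  rewrite exprMn (prim_expr_order thetaP) /a -exprM mulnC exprM (prim_expr_order thetaP).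
  rewrite expr1n mulr1 l_eq exprS -muln2 mulnC exprM sqrrN !expr1n mulr1 => /esym/eqP.
  by rewrite (negPf (neg1_neq1 two_neq0)).
by rewrite -p_prim -(eq_prim_root_expr thetaP) expr1 -/a aE.
Qed.

Definition hroot := xi ^+ 2.

Let n0 : (0 < n)%N := ltnW n_gt1.

Lemma hroot_neq0 : hroot != 0.
Proof. by rewrite expf_neq0 ?xi_neq0. Qed.

Lemma hroot_subF : hroot \in subF p L n.
Proof. by rewrite mem_subF // -exprM mulnC exprM xi_half sqrrN. Qed.

Lemma hroot_period j : (0 < j)%N -> hroot \in subF p L j -> (n %| j)%N.
Proof.
move=> jp; rewrite mem_subF // -exprM mulnC exprM eqf_sqr => E.
have : xi ^+ (p ^ (j * 2)) = xi.
  rewrite muln2 -addnn expnD exprM.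
  by case/orP: E => /eqP E; rewrite !E // (exppN charL) E opprK.
move/xi_period; rewrite {1}l_eq /= -muln2 dvdn_pmul2r //.
Qed.

Lemma hroot_conj_uniq : uniq [seq hroot ^+ (p ^ t) | t <- index_iota 0 n].
Proof. by apply: (conj_uniq charL) => //; exact: hroot_period. Qed.

Lemma xi_conj_uniq : uniq (0 :: [seq xi ^+ (p ^ t) | t <- index_iota 0 l.-1]).
Proof.
rewrite /=; apply/andP; split.
  by apply/mapP => -[t _ /eqP]; rewrite eq_sym expf_eq0 (negPf xi_neq0) andbF.
apply: (conj_uniq charL); first by rewrite l_eq /= double_gt0.
by move=> j jp; rewrite mem_subF // => /eqP; exact: xi_period.
Qed.

(** These are l distinct roots of a monic polynomial of degree l. *)
Lemma chebyshev_roots :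
  map_poly intr (Chebyshev l) = 'X * \prod_(0 <= t < l.-1) ('X - (xi ^+ (p ^ t))%:P) :> {poly L}.
Proof.
have [mC sC] := Chebyshev_monic (prime_gt0 l_pr).
pose s := 0 :: [seq xi ^+ (p ^ t) | t <- index_iota 0 l.-1].
have mP : (map_poly intr (Chebyshev l) : {poly L}) \is monic by exact: monic_map.
have root_e (e : nat) : (map_poly intr (Chebyshev l)).[i * (theta ^+ e - theta ^- e)] = 0 :> L.
  have iV : i^-1 = - i.
    by apply: (mulfI i0); rewrite mulfV // mulrN -expr2 i2 opprK.
  pose u := i * theta ^+ e.
  have u0 : u != 0 by rewrite mulf_neq0 ?expf_neq0.
  have -> : i * (theta ^+ e - theta ^- e) = u + u^-1.
    by rewrite /u invfM iV mulrBr mulNr.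
  rewrite chebyshev_eval // /u exprMn -exprM mulnC exprM (prim_expr_order thetaP).
  have il : i ^+ l = i.
    rewrite (divn_eq l 4) l_mod4 exprD mulnC exprM.
    by rewrite (exprM i 2 2) i2 sqrrN !expr1n mul1r.
  by rewrite expr1n mulr1 il iV subrr.
have := @all_roots_prod_XsubC _ (map_poly intr (Chebyshev l)) s.
rewrite (monicP mP) scale1r big_cons subr0 big_map; apply.
- rewrite size_map_poly_id0 ?sC /= ?size_map ?size_iota ?(monicP mC) ?rmorph1 ?oner_eq0 //.
  by rewrite subn0 prednK ?prime_gt0.
- apply/allP => x; rewrite inE => /orP[/eqP ->|/mapP[t _ ->]]; rewrite rootE.
    by have := root_e 0%N; rewrite expr0 invr1 subrr mulr0 => ->.
  by rewrite xi_pX root_e.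
by rewrite uniq_rootsE xi_conj_uniq.
Qed.

(** The minimal polynomial over F_p of the square of a nonzero root of the
    Chebyshev polynomial. *)
Definition hpoly := normpoly emb n hroot.

Lemma hpolyK : map_poly emb hpoly = conjpoly p n hroot.
Proof. exact: normpolyK hroot_subF. Qed.

(** Half of the nonzero roots xi^(p^t) are the opposites of the other half, by
    [xi_half]. *)
Lemma chebyshev_hpoly (x : L) :
  (map_poly intr (Chebyshev l)).[x] = x * (map_poly emb hpoly).[x ^+ 2].
Proof.
rewrite chebyshev_roots hornerM hornerX hpolyK; congr (_ * _).
rewrite !horner_prod l_eq /= -addnn (big_cat_nat (n := n)) ?leq_addr //=.
have shift (G : nat -> L) : \prod_(n <= t < n + n) G t = \prod_(0 <= t < n) G (t + n)%N.
  by rewrite -{1}[n]add0n big_addn addnK.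
rewrite shift -big_split /=; apply: eq_bigr => t _.
rewrite !hornerE addnC expnD exprM xi_half (exppN charL).
by rewrite -exprM mulnC exprM; ring.
Qed.

Local Notation "f ^^" := (map_poly emb f) (at level 2, format "f ^^").
Local Notation w := hroot.
Local Notation h := hpoly.

Let two0 : 2%:R != 0 :> L := two_neq0.
Let w_fix : w \in subF p L n := hroot_subF.
Let hK : h^^ = conjpoly p n w := hpolyK.

(** For v = u^2 this is the square of phi_l(u + 1/u) = u^l + u^(-l). *)
Lemma dickson_eval (v : L) : v != 0 ->
  (v + v^-1 + 2%:R) * h^^.[v + v^-1 + 2%:R] ^+ 2 = v ^+ l + v ^- l + 2%:R.
Proof.
move=> v0.
have [u uv] := sqrt_exists v.
have u0 : u != 0 by apply: contraNneq v0 => E; rewrite -uv E expr0n.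
have -> : v + v^-1 + 2%:R = (u + u^-1) ^+ 2.
  by rewrite sqrrD -uv exprVn mulfV //; ring.
rewrite -exprMn -chebyshev_hpoly chebyshev_eval // sqrrD mulfV ?expf_neq0 //.
by rewrite -exprM mulnC exprM uv exprVn -exprM mulnC exprM uv; ring.
Qed.

(** With z = v + 1/v + 2, equal values for v and v' mean v^l = v'^l or
    v^l = 1 / v'^l. The numbers v lie in the extension of degree 2, whose
    multiplicative group has order prime to l when j < n. *)
Lemma dickson_inj j : (0 < j < n)%N ->
  {in subF p L j &, injective (fun z => z * h^^.[z] ^+ 2)}.
Proof.
case/andP=> jp jn.
have param z : z \in subF p L j -> exists v, [/\ v != 0, z = v + v^-1 + 2%:R &
    v ^+ (p ^ (j * 2)) = v].
  rewrite mem_subF // => /eqP zj.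
  have [r r2] := sqrt_exists ((z - 2%:R) ^+ 2 - 4%:R).
  pose v := (z - 2%:R + r) / 2%:R.
  have vE : v ^+ 2 - (z - 2%:R) * v + 1 = 0.
    have -> : v ^+ 2 - (z - 2%:R) * v + 1 = (r ^+ 2 - ((z - 2%:R) ^+ 2 - 4%:R)) / 4%:R.
      rewrite /v; field.
      by rewrite two_neq0 (natrM _ 2 2) mulf_neq0 ?two_neq0.
    by rewrite r2 subrr mul0r.
  have v0 : v != 0.
    by apply: contra_eq_neq vE => ->; rewrite expr0n mulr0 subr0 add0r oner_neq0.
  have zE : z = v + v^-1 + 2%:R.
    apply: (mulIf v0); rewrite !mulrDl mulVf //.
    by apply/eqP; rewrite -subr_eq0 -oppr_eq0; apply/eqP; rewrite -[RHS]vE; ring.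
  exists v; split=> //; rewrite muln2 -addnn expnD exprM.
  set V := v ^+ (p ^ j).
  have V0 : V != 0 by rewrite expf_neq0.
  have /eqP : V + V^-1 + 2%:R = z.
    rewrite -[RHS]zj zE !(exppD charL) exprVn -/V; congr (_ + _).
    by rewrite !expr1n.
  rewrite zE => /eqP/addIr E.
  have /eqP : (V - v) * (V * v - 1) = 0.
    have : (V + V^-1 - (v + v^-1)) * (V * v) = 0 by rewrite E subrr mul0r.
    move=> <-; field; exact/andP.
  rewrite mulf_eq0 !subr_eq0 => /orP[/eqP Vv|/eqP Vv]; first by rewrite Vv -/V Vv.
  have VE : V = v^-1 by apply: (mulIf v0); rewrite mulVf.
  by rewrite VE exprVn -/V VE invrK.
have l_coprime (x : L) : x != 0 -> x ^+ (p ^ (j * 2)) = x -> x ^+ l = 1 -> x = 1.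
  move=> x0 xp xl; have [m xm ml] := prim_order_exists (prime_gt0 l_pr) xl.
  have [/eqP m1|/eqP ml'] := orP ((primeP l_pr).2 m ml).
    by have := prim_expr_order xm; rewrite m1 expr1.
  have /ndvd_l/negP[] : ~~ (l.-1 %| j * 2)%N.
    apply/negP=> /dvdn_leq; rewrite muln2 l_eq /= leq_double; lia.
  rewrite -ml' (prim_order_dvd xm) -[X in _ == X](divff x0) -(inj_eq (mulIf x0)).
  by rewrite -exprSr subn1 prednK ?expn_gt0 ?prime_gt0 // xp mulfVK.
move=> z z' /param[v [v0 -> vp]] /param[v' [v'0 -> v'p]].
rewrite !dickson_eval // => /addIr E; congr (_ + _).
have key (y : L) : y != 0 -> y ^+ (p ^ (j * 2)) = y -> v ^+ l = y ^+ l -> v = y.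
  move=> y0 yp vy; apply: (mulIf (x := y^-1)); rewrite ?invr_eq0 // mulfV //.
  apply: l_coprime; rewrite ?mulf_neq0 ?invr_eq0 // exprMn exprVn ?vp ?yp //.
  by rewrite vy mulfV // expf_neq0.
have /eqP : (v ^+ l - v' ^+ l) * (v ^+ l * v' ^+ l - 1) = 0.
  have : (v ^+ l + v ^- l - (v' ^+ l + v' ^- l)) * (v ^+ l * v' ^+ l) = 0.
    by rewrite E subrr mul0r.
  move=> <-; field; rewrite !expf_neq0 //.
rewrite mulf_eq0 !subr_eq0 => /orP[/eqP vv|/eqP vv].
  by rewrite (key v').
rewrite (key v'^-1) ?invr_eq0 ?exprVn ?v'p // ?invrK 1?addrC //.
by apply: (mulIf (x := v' ^+ l)); rewrite ?expf_neq0 // mulVf ?expf_neq0.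
Qed.

(** * Quartic and quadratic symbols on the finite subfields *)

(** The quartic symbol of x in the field with p^j elements is the fourth root of
    unity [x ^+ quart j], and its quadratic symbol is [x ^+ (quart j * 2)]. *)
Definition quart j : nat := ((p ^ j).-1 %/ 4)%N.

Lemma quart4 j : (quart j * 4 = (p ^ j).-1)%N.
Proof.
rewrite divnK // -subn1 -eqn_mod_dvd ?expn_gt0 ?prime_gt0 //.
by rewrite -modnXm p_mod4 modnXm exp1n.
Qed.

(** The quartic symbol over the field with p^j elements is that of the norm to
    F_p. *)
Lemma quart_sum j : (quart j = quart 1 * \sum_(t < j) p ^ t)%N.
Proof.
apply/eqP; rewrite -(eqn_pmul2r (isT : (0 < 4)%N)) mulnAC !quart4 expn1.
by rewrite predn_exp.
Qed.

Lemma quart_gt0 j : (0 < j)%N -> (0 < quart j)%N.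
Proof.
move=> jp; have := quart4 j; have : (p ^ 1 <= p ^ j)%N by rewrite leq_exp2l ?prime_gt1.
by have := prime_gt1 p_pr; rewrite expn1; move: p_mod4; case: (quart j); lia.
Qed.

Lemma in_mu4_quart j (x : L) : (0 < j)%N -> x \in subF p L j -> in_mu4 (x ^+ quart j).
Proof.
move=> jp xj; case: (eqVneq x 0) => [->|x0].
  by left; rewrite expr0n eqn0Ngt quart_gt0.
by right; rewrite -exprM quart4 subF_expr1.
Qed.

Lemma prod_conj_expr (x : L) j : x ^+ quart j = (\prod_(0 <= t < j) x ^+ (p ^ t)) ^+ quart 1.
Proof. by rewrite quart_sum mulnC exprM prodrXr big_mkord. Qed.

Definition hconst : 'F_p := h.[0].

Lemma prodN_n (G : nat -> L) :
  \prod_(0 <= t < n) - G t = \prod_(0 <= t < n) G t.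
Proof.
under eq_bigr => t _ do rewrite -mulN1r.
rewrite big_split /= prodr_const_nat subn0 -[n in X in X * _]odd_double_half.
by rewrite (negPf n_even) add0n -muln2 mulnC exprM sqrrN !expr1n mul1r.
Qed.

Lemma hconst_norm : emb hconst = (\prod_(0 <= t < n) xi ^+ (p ^ t)) ^+ 2.
Proof.
rewrite /hconst -horner_map /= rmorph0 hK horner_prod.
under eq_bigr => t _ do rewrite !hornerE.
rewrite prodN_n -prodrXl; apply: eq_bigr => t _.
by rewrite -exprM mulnC exprM.
Qed.

Definition hquart : L := emb hconst ^+ quart 1.

(** The product y of the xi^(p^t), t < n, is a square root of [hconst]. The
    Frobenius replaces its factor xi by xi^(p^n) = - xi, so y is not in F_p, and
    [hconst] is not a square there. *)
Lemma hquart_sqr : hquart ^+ 2 = -1.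
Proof.
rewrite /hquart hconst_norm; set y := \prod_(_ <= _ < _) _.
have y0 : y != 0.
  by rewrite prodf_seq_neq0; apply/allP=> t _; rewrite expf_neq0 // xi_neq0.
have yp : y ^+ p = - y.
  rewrite /y -prodrXl; under eq_bigr => t _ do rewrite -exprM -expnSr.
  move: n0 xi_half.
  case: n => // k _ E; rewrite big_nat_recr //= [in RHS]big_nat_recl //= E.
  by rewrite expr1 mulrN mulrC.
rewrite -!exprM; have -> : (2 * (quart 1 * 2) = p.-1)%N.
  by have := quart4 1; rewrite expn1; lia.
apply: (mulIf y0); rewrite -exprSr prednK ?prime_gt0 // yp mulN1r //.
Qed.

Lemma hconst_neq0 : hconst != 0.
Proof.
have := hquart_sqr; rewrite /hquart; apply: contra_eq_neq => ->.
by rewrite rmorph0 -exprM expr0n muln_eq0 orbF eqn0Ngt quart_gt0 //= eq_sym oppr_eq0 oner_eq0.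
Qed.

Local Notation mu4 := (mu4 hquart).
Let muM := mu4M hquart_sqr two0.
Let muX := mu4X hquart_sqr two0.

Definition chi (y : L) : algC := mu4 (y ^+ (quart n * 2)).

Definition eta (a : 'F_p) : algC := mu4 (emb a ^+ quart 1).

(** The Dirichlet character with modulus X h: evaluating at [w] is reducing
    modulo h. *)
Definition Psi (f : {poly 'F_p}) : algC := eta f.[0] * chi f^^.[w].

Lemma etaM : {morph eta : a b / a * b}.
Proof.
move=> a b; rewrite /eta rmorphM exprMn muM //.
  by apply: in_mu4_quart => //; exact: fp_subF.
by apply: in_mu4_quart => //; exact: fp_subF.
Qed.

Lemma in_mu4_chi y : y \in subF p L n -> in_mu4 (y ^+ (quart n * 2)).
Proof. by move=> yn; rewrite exprM; apply: in_mu4X; exact: in_mu4_quart. Qed.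

Lemma chiM : {in subF p L n &, {morph chi : x y / x * y}}.
Proof. by move=> x y xn yn; rewrite /chi exprMn muM //; exact: in_mu4_chi. Qed.

Lemma eta_hconst : eta hconst = 'i.
Proof. exact: mu4_i hquart_sqr two0. Qed.

Lemma eta1 : eta 1 = 1.
Proof. by rewrite /eta rmorph1 expr1n mu4_1. Qed.

Lemma chi0 : chi 0 = 0.
Proof. by rewrite /chi expr0n muln_eq0 orbF eqn0Ngt quart_gt0 // mu4_0. Qed.

(** Since n is even, (p^n - 1) / 2 is a multiple of p^(n/2) - 1, hence of the order
    of an element of F_p. *)
Lemma chi_const (a : 'F_p) : a != 0 -> chi (emb a) = 1.
Proof.
move=> a0; rewrite /chi.
have nE : n = (n./2 * 2)%N.
  by rewrite muln2 -[LHS]odd_double_half (negPf n_even).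
have k0 : (0 < n./2)%N by move: n0; rewrite nE; lia.
have E : (quart n * 2 = (p ^ n./2).-1 * ((p ^ n./2).+1 %/ 2))%N.
  have po : odd (p ^ n./2).
    by rewrite oddX; apply/orP; right; move: p_mod4; lia.
  have := quart4 n; rewrite [in (p ^ n)%N]nE expnM.
  move: po; set q := (p ^ _)%N; set e := quart n.
  have : (0 < q)%N by rewrite expn_gt0 prime_gt0.
  move=> q0 qo; have [k qE] : exists k, q = k.*2.+1.
    by exists q./2; rewrite -[LHS]odd_double_half qo.
  have -> : (q.+1 %/ 2 = k.+1)%N by lia.
  rewrite qE; nia.
rewrite E exprM subF_expr1 ?fp_subF ?fmorph_eq0 // expr1n mu4_1 //.
Qed.

Lemma PsiM f g : Psi (f * g) = Psi f * Psi g.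
Proof.
rewrite /Psi hornerM etaM rmorphM /= hornerM chiM ?horner_subF //.
by rewrite mulrACA.
Qed.

Lemma Psi_1 : Psi 1 = 1.
Proof. by rewrite /Psi hornerC eta1 rmorph1 hornerC -(rmorph1 emb) chi_const ?oner_eq0 // mulr1. Qed.

(** * The coefficients of the L-function *)

Local Notation moncoef := (moncoef Psi).
Local Notation powsum := (powsum emb Psi).

Lemma hpoly_monic : h \is monic.
Proof. by rewrite -(map_monic emb) hK conjpoly_monic. Qed.

Lemma size_hpoly : size h = n.+1.
Proof. by rewrite -(size_map_poly emb) hK size_conjpoly. Qed.

Lemma hpoly_root : h^^.[w] = 0.
Proof. by rewrite hK horner_prod big_ltn // !hornerE expr1 subrr mul0r. Qed.

(** Multiplying by a constant c changes [Psi] by [eta c], as the degree n of h is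
    even. To stay among the monic polynomials, the multiplication is centred at
    a monic multiple G of X h, which exists in every degree above n. *)
Lemma moncoef_high m : (n < m)%N -> moncoef m = 0.
Proof.
move=> nm; pose G := 'X^(m - n) * h.
have Gm : G \is monic by rewrite monicMl ?monicXn ?hpoly_monic.
have sG : size G = m.+1.
  by rewrite size_mul ?monic_neq0 ?monicXn ?hpoly_monic // size_polyXn size_hpoly; lia.
have G0 : G.[0] = 0 by rewrite hornerM hornerXn expr0n subn_eq0 leqNgt nm mul0r.
have Gw : G^^.[w] = 0 by rewrite rmorphM /= hornerM hpoly_root mulr0.
(* Any constant whose quartic symbol is not 1 would serve. *)
pose T (f : {poly 'F_p}) := hconst *: (f - G) + G.
have PT f : Psi (T f) = 'i * Psi f.
  rewrite /Psi /T -eta_hconst [RHS]mulrA -etaM.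
  rewrite hornerD hornerZ hornerD hornerN G0 subr0 addr0.
  rewrite rmorphD /= map_polyZ rmorphB /= hornerD hornerZ hornerD hornerN Gw subr0 addr0.
  by rewrite chiM ?fp_subF ?horner_subF // chi_const ?hconst_neq0 // mul1r.
apply: (fixed_by_scalar sqrtCi_neq1).
rewrite /moncoef mulr_sumr -[LHS](big_reindex_seq (s := monic_polys 'F_p m) (f := T)) //.
  - by apply: eq_bigr => f _; exact: PT.
  - exact: monic_polys_uniq.
  - exact: monic_polys_uniq.
  - by move=> f g _ _ /addIr/(scalerI hconst_neq0)/addIr.
  move=> f; rewrite !mem_monic_polys => /andP[fm /eqP sf].
  have lt : (size (hconst *: (f - G)) < size G)%N.
    rewrite size_scale ?hconst_neq0 // sG ltnS; apply/leq_sizeP=> j; rewrite leq_eqVlt coefB.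
    case/orP=> [/eqP <-|mj]; last by rewrite !nth_default ?subrr ?sf ?sG.
    have := monicP fm; have := monicP Gm; rewrite !lead_coefE sf sG /= => -> ->.
    exact: subrr.
  by rewrite /T [_ + G]addrC monicE lead_coefDl // -monicE Gm size_polyDl // sG eqxx.
Qed.

Lemma eval_inj : {in polys_lt 'F_p n &, injective (fun r : {poly 'F_p} => r^^.[w])}.
Proof.
move=> r s; rewrite !mem_polys_lt => sr ss E; apply/eqP; rewrite -subr_eq0.
rewrite -(map_poly_eq0 emb); apply: contraT => D0.
have : all (root (r - s)^^) [seq w ^+ (p ^ t) | t <- index_iota 0 n].
  apply/allP=> _ /mapP[t _ ->]; rewrite rootE -(horner_Frob charL) rmorphB /= hornerD hornerN E.
  by rewrite subrr expr0n expn_eq0 eqn0Ngt prime_gt0.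
move/(max_poly_roots D0)/(_ hroot_conj_uniq).
rewrite size_map size_iota subn0 size_map_poly ltnNge.
by rewrite (leq_trans (size_polyD _ _)) // geq_max sr size_polyN.
Qed.

Lemma sum_eval (E : L -> algC) :
  \sum_(r <- polys_lt 'F_p n) E r^^.[w] = \sum_(x <- subF p L n) E x.
Proof.
apply: (big_reindex_seq (f := fun r : {poly 'F_p} => r^^.[w])).
- exact: polys_lt_uniq.
- exact: subF_uniq.
- exact: eval_inj.
- by move=> r _; exact: horner_subF.
by rewrite size_polys_lt card_Fp // size_subF.
Qed.

(** w = xi^2, and w^((p^n - 1) / 2) = xi^(p^n - 1) = -1. *)
Lemma chi_hroot : chi w = -1.
Proof.
rewrite /chi /hroot -exprM.
have -> : (2 * (quart n * 2) = (p ^ n).-1)%N by rewrite -quart4; lia.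
have -> : xi ^+ (p ^ n).-1 = -1.
  apply: (mulIf xi_neq0); rewrite -exprSr prednK ?expn_gt0 ?prime_gt0 //.
  by rewrite xi_half mulN1r.
exact: mu4_N1 two0.
Qed.

Lemma sum_chi : \sum_(x <- subF p L n) chi x = 0.
Proof.
have : \sum_(x <- subF p L n) chi x = - \sum_(x <- subF p L n) chi x.
  rewrite -[LHS](sum_subF_scale charL _ n0 w_fix hroot_neq0) -sumrN big_seq [RHS]big_seq.
  by apply: eq_bigr => x xn; rewrite chiM // chi_hroot mulN1r.
by move/eqP; rewrite -addr_eq0 -mulr2n mulrn_eq0 => /eqP.
Qed.

(** Sums of the quadratic symbol over the cosets of a hyperplane of F_{p^n}. *)
Definition fibre (t : 'F_p) : algC := \sum_(r <- polys_lt 'F_p n | r.[0] == t) chi r^^.[w].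

Lemma sum_fibre (E : 'F_p -> algC) :
  \sum_(r <- polys_lt 'F_p n) E r.[0] * chi r^^.[w] = \sum_t E t * fibre t.
Proof.
rewrite (partition_big (fun r : {poly 'F_p} => r.[0]) predT) //=.
apply: eq_bigr => t _; rewrite /fibre mulr_sumr.
by apply: eq_bigr => r /eqP ->.
Qed.

Lemma fibreZ t : t != 0 -> fibre t = fibre 1.
Proof.
move=> t0; rewrite /fibre [LHS]big_mkcond [RHS]big_mkcond /=.
rewrite -[LHS](big_reindex_seq (s := polys_lt 'F_p n) (f := fun r => t *: r)).
- rewrite big_seq [RHS]big_seq; apply: eq_bigr => r _.
  rewrite hornerZ -{2}[t]mulr1 (inj_eq (mulfI t0)); case: ifP => // _.
  rewrite map_polyZ hornerZ chiM ?fp_subF ?horner_subF //.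
  by rewrite chi_const // mul1r.
- exact: polys_lt_uniq.
- exact: polys_lt_uniq.
- by move=> r s _ _; exact: scalerI.
- by move=> r; rewrite !mem_polys_lt size_scale.
by [].
Qed.

Lemma sum_fibres (E : 'F_p -> algC) :
  \sum_t E t * fibre t = E 0 * (fibre 0 - fibre 1) + (\sum_t E t) * fibre 1.
Proof.
rewrite (bigD1 0) //= [in RHS](bigD1 0) //= mulrBr mulrDl addrA subrK; congr (_ + _).
rewrite mulr_suml; apply: eq_bigr => t t0; by rewrite fibreZ.
Qed.

(** The quadratic Gauss sum of F_{p^n} for an additive character that depends on
    [r.[0]] only: by [fibreZ] the values of the character at the nonzero
    constants add up to -1. This form shows that it does not depend on the
    choice of the character. *)
Definition gauss := fibre 0 - fibre 1.

Lemma sum_eta_shift : \sum_t eta (hconst + t) = 0.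
Proof.
have -> : \sum_t eta (hconst + t) = \sum_t eta t by rewrite [RHS](reindex_inj (addrI hconst)).
apply: (fixed_by_scalar sqrtCi_neq1).
rewrite {1}(reindex_inj (mulfI hconst_neq0)) mulr_sumr.
by apply: eq_bigr => t _; rewrite etaM eta_hconst.
Qed.

(** The monic polynomials of degree n are the h + r with deg r < n, and
    Psi (h + r) = eta (h(0) + r(0)) chi (r(w)). *)
Lemma moncoef_n : moncoef n = 'i * gauss.
Proof.
transitivity (\sum_(r <- polys_lt 'F_p n) eta (hconst + r.[0]) * chi r^^.[w]).
  rewrite /moncoef -(big_reindex_seq (s := polys_lt 'F_p n) (f := fun r => h + r)).
  - apply: eq_bigr => r _; rewrite /Psi hornerD rmorphD /= hornerD hpoly_root add0r //.
  - exact: polys_lt_uniq.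
  - exact: monic_polys_uniq.
  - by move=> r s _ _; exact: addrI.
  - move=> r; rewrite mem_polys_lt mem_monic_polys => sr.
    have lt : (size r < size h)%N by rewrite size_hpoly.
    by rewrite monicE lead_coefDl // -monicE hpoly_monic size_polyDl // size_hpoly /=.
  by rewrite size_monic_polys size_polys_lt.
rewrite (sum_fibre (fun t => eta (hconst + t))) sum_fibres addr0 eta_hconst.
by rewrite sum_eta_shift mul0r addr0.
Qed.

Section AdditiveCharacter.

Variable (zeta : algC).
Hypothesis zetaP : p.-primitive_root zeta.

Definition psi (a : 'F_p) : algC := zeta ^+ a.

Lemma psiD a b : psi (a + b) = psi a * psi b.
Proof.
by rewrite /psi -exprD /= -[RHS](prim_expr_mod zetaP) [X in zeta ^+ (_ %% X)](Fp_cast p_pr).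
Qed.

Lemma psi0 : psi 0 = 1.
Proof. by rewrite /psi expr0. Qed.

Lemma psi1_neq1 : psi 1 != 1.
Proof.
have -> : psi 1 = zeta ^+ 1 by [].
by rewrite -(prim_order_dvd zetaP) dvdn1 neq_ltn prime_gt1 ?orbT.
Qed.

Lemma sum_psi : \sum_a psi a = 0.
Proof.
apply: (fixed_by_scalar psi1_neq1); rewrite {1}(reindex_inj (addrI 1)) mulr_sumr.
by apply: eq_bigr => a _; rewrite psiD.
Qed.

Let residue (x : L) : {poly 'F_p} :=
  nth 0 (polys_lt 'F_p n) (index x [seq r^^.[w] | r <- polys_lt 'F_p n]).

Let residue_eval r : r \in polys_lt 'F_p n -> residue r^^.[w] = r.
Proof.
move=> rn; rewrite /residue; set s := map _ _.
have E : r^^.[w] \in s by apply/mapP; exists r.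
have lt := E; rewrite -index_mem size_map in lt.
apply: eval_inj => //; first exact: mem_nth.
by rewrite -(nth_map 0 0 (fun q : {poly 'F_p} => q^^.[w])) // nth_index.
Qed.

Let subF_eval x : x \in subF p L n -> exists2 r, r \in polys_lt 'F_p n & x = r^^.[w].
Proof.
have um : uniq [seq r^^.[w] | r <- polys_lt 'F_p n].
  by rewrite map_inj_in_uniq ?polys_lt_uniq //; exact: eval_inj.
have [||_ <-] := uniq_min_size um (s2 := subF p L n).
- by move=> _ /mapP[r _ ->]; exact: horner_subF.
- by rewrite size_map size_polys_lt size_subF // card_Fp.
by case/mapP=> r rn ->; exists r.
Qed.

Definition psi_n (x : L) := psi (residue x).[0].

Lemma gauss_sqr_psi : gauss ^+ 2 = (p ^ n)%:R.
Proof.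
have small_add r s : r \in polys_lt 'F_p n -> s \in polys_lt 'F_p n -> r + s \in polys_lt 'F_p n.
  by rewrite !mem_polys_lt => rn sn; rewrite (leq_trans (size_polyD _ _)) // geq_max rn.
have -> : gauss = \sum_(x <- subF p L n) chi x * psi_n x.
  rewrite -sum_eval big_seq.
  under eq_bigr => r rn do rewrite /psi_n residue_eval // mulrC.
  by rewrite -big_seq sum_fibre sum_fibres sum_psi mul0r addr0 psi0 mul1r.
rewrite (@gauss_sum_sqr _ _ (subF p L n)).
- rewrite size_subF // -[-1](rmorphN1 emb) chi_const ?mul1r //.
  by rewrite oppr_eq0 oner_eq0.
- exact: subF_uniq.
- by rewrite -(rmorphN1 emb) fp_subF.
- exact: subF_add.
- exact: subF_mul.
- exact: chi0.
- exact: chiM.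
- move=> x xn x0; rewrite /chi -muX; last exact: in_mu4_chi.
  rewrite -exprM -mulnA quart4 subF_expr1 //.
  by rewrite mu4_1.
- exact: sum_chi.
- have := @residue_eval 0; rewrite mem_polys_lt size_poly0 rmorph0 horner0 => /(_ isT) E.
  by rewrite /psi_n E horner0 psi0.
- move=> x y /subF_eval[r rn ->] /subF_eval[s sn ->].
  by rewrite /psi_n -hornerD -rmorphD /= !residue_eval ?small_add // hornerD psiD.
rewrite -sum_eval big_seq; under eq_bigr => r rn do rewrite /psi_n residue_eval //.
rewrite -big_seq; apply: (fixed_by_scalar psi1_neq1).
have one_n : (1 : {poly 'F_p}) \in polys_lt 'F_p n by rewrite mem_polys_lt size_poly1.
rewrite -{1}(big_reindex_seq (s := polys_lt 'F_p n) (f := fun r => 1 + r)) ?polys_lt_uniq //.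
- by rewrite mulr_sumr; apply: eq_bigr => r _; rewrite hornerD hornerC psiD.
- by move=> r s _ _; exact: addrI.
by move=> r rn; exact: small_add.
Qed.

End AdditiveCharacter.

Lemma gauss_sqr : gauss ^+ 2 = (p ^ n)%:R.
Proof. by have [zeta zP] := C_prim_root_exists (prime_gt0 p_pr); exact: gauss_sqr_psi zP. Qed.

Lemma moncoef_n_sqr : moncoef n ^+ 2 = - (p ^ n)%:R.
Proof. by rewrite moncoef_n exprMn sqrCi gauss_sqr mulN1r. Qed.

(** * The power sums of the L-function *)

(** Both sides are the quadratic symbol in F_p of the product of the differences
    between the conjugates of w and those of z, that is, of the resultant of
    their characteristic polynomials. *)
Lemma reciprocity j z : (0 < j)%N -> z \in subF p L j ->
  (conjpoly p j z).[w] ^+ (quart n * 2) = h^^.[z] ^+ (quart j * 2).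
Proof.
move=> jp zj; rewrite !exprM (prod_conj_expr _ n) (prod_conj_expr _ j).
rewrite -(normpolyK charL emb jp zj).
under eq_bigr => t _ do rewrite (horner_Frob charL) (normpolyK charL emb jp zj) horner_prod.
under [in RHS]eq_bigr => t _ do rewrite (horner_Frob charL) hK horner_prod.
rewrite [in RHS]exchange_big /= -!exprM (mulnC (quart 1)) !(exprM _ 2); congr (_ ^+ _).
rewrite -!prodrXl; apply: eq_bigr => t _; rewrite -!prodrXl; apply: eq_bigr => s _.
by rewrite !hornerE -sqrrN opprB.
Qed.

(** The value at 0 of the characteristic polynomial of z is (-1)^j times the norm
    of z to F_p, which has the quartic symbol of z. *)
Lemma Psi_normpoly j z : (0 < j)%N -> z \in subF p L j ->
  Psi (normpoly emb j z) = mu4 ((-1) ^+ (j * quart 1)) * mu4 ((z * h^^.[z] ^+ 2) ^+ quart j).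
Proof.
move=> jp zj; rewrite /Psi /eta /chi -horner_map /= rmorph0 (normpolyK charL emb jp zj).
rewrite reciprocity // [(quart j * 2)%N]mulnC exprM [(z * _) ^+ _]exprMn.
rewrite [mu4 (z ^+ _ * _)]muM; last 2 first.
- exact: in_mu4_quart.
- by rewrite -exprM mulnC exprM; apply: in_mu4X; apply: in_mu4_quart => //; exact: horner_subF.
rewrite mulrA; congr (_ * _).
have -> : (conjpoly p j z).[0] ^+ quart 1 = (-1) ^+ (j * quart 1) * z ^+ quart j.
  rewrite horner_prod (prod_conj_expr _ j) exprM -exprMn; congr (_ ^+ _).
  rewrite -[X in (-1) ^+ X]subn0 -prodr_const_nat -big_split /=.
  by apply: eq_bigr => t _; rewrite !hornerE mulN1r.
rewrite muM //; last exact: in_mu4_quart.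
by right; rewrite -exprM mulnC exprM [X in X ^+ _](exprM _ 2 2) sqrrN !expr1n.
Qed.

Lemma sum_quart j : (0 < j)%N -> \sum_(z <- subF p L j) mu4 (z ^+ quart j) = 0.
Proof.
move=> jp.
(* The nonzero elements are too many to be roots of X^(quart j) - 1. *)
have [g gj /andP[g0 g1]] : exists2 g, g \in subF p L j & (g != 0) && (g ^+ quart j != 1).
  apply/hasP; apply: contraT; rewrite -all_predC => /allP no.
  have z0 : (0 : L) \in subF p L j by rewrite -(rmorph0 emb) fp_subF.
  have : (size (rem (0%R : L) (subF p L j)) <= quart j)%N.
    apply: max_unity_roots; rewrite ?quart_gt0 ?rem_uniq ?subF_uniq //.
    apply/allP=> x; rewrite mem_rem_uniq ?subF_uniq // inE => /andP[x0 /no] /=.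
    by rewrite x0 negbK unity_rootE.
  rewrite size_rem // size_subF // -quart4.
  by have := quart_gt0 jp; lia.
have mg1 : mu4 (g ^+ quart j) != 1.
  by apply: contraNneq g1 => /(mu4_eq1 hquart_sqr two0 (in_mu4_quart jp gj)) ->.
apply: (fixed_by_scalar mg1).
rewrite -[LHS](sum_subF_scale charL _ jp gj g0) mulr_sumr big_seq [RHS]big_seq.
by apply: eq_bigr => z zj; rewrite exprMn muM //; exact: in_mu4_quart.
Qed.

(** The Dickson polynomial z h(z)^2 permutes the field with p^j elements, and up
    to a constant sign the summand is the quartic symbol of its value. *)
Lemma powsum_low j : (0 < j < n)%N -> powsum j = 0.
Proof.
move=> jn; have [jp _] := andP jn; rewrite /powsum big_seq.
under eq_bigr => z zj do rewrite Psi_normpoly //.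
rewrite -mulr_sumr -big_seq [X in _ * X](_ : _ = 0) ?mulr0 // -[RHS](sum_quart jp).
apply: (big_reindex_seq (f := fun z => z * h^^.[z] ^+ 2) (fun x => mu4 (x ^+ quart j))).
- exact: subF_uniq.
- exact: subF_uniq.
- exact: dickson_inj.
- by move=> z zj; rewrite subF_mul ?[_ ^+ 2]expr2 ?subF_mul ?horner_subF.
by [].
Qed.

Lemma powsum_values : powsum n = n%:R * moncoef n /\
  forall m, (n < m)%N -> powsum m = - (powsum (m - n) * moncoef n).
Proof.
have [] := powsum_recurrence charL PsiM (n := n) (emb := emb) => //.
- exact: moncoef_high.
- exact: powsum_low.
rewrite /moncoef; have -> : monic_polys 'F_p 0 = [:: 1].
  apply/perm_small_eq => //; apply: uniq_perm => //; first exact: monic_polys_uniq.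
  move=> f; rewrite mem_monic_polys inE; apply/andP/eqP => [[fm /eqP sf]|->]; last first.
    by rewrite monic1 size_poly1.
  have := size1_polyC (eq_leq sf) => fE; move: fm.
  by rewrite fE monicE lead_coefC => /eqP ->.
by rewrite big_seq1 Psi_1.
Qed.

Lemma powsum_multiple k : powsum (k.+1 * n) = (-1) ^+ k * n%:R * moncoef n ^+ k.+1.
Proof.
have [e rec] := powsum_values; elim: k => [|k IH]; first by rewrite mul1n e mul1r.
rewrite rec; last by rewrite -[X in (X < _)%N]mul1n ltn_pmul2r.
by rewrite mulSn addKn IH !exprS; ring.
Qed.

Lemma powsum_nonmultiple m : (0 < m)%N -> ~~ (n %| m)%N -> powsum m = 0.
Proof.
have [e rec] := powsum_values; elim/ltn_ind: m => m IH m0 nd.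
have [mn|nm|mE] := ltngtP m n; first by rewrite powsum_low ?m0.
  rewrite rec // IH ?mul0r ?oppr0 // ?subn_gt0 //; first by rewrite ltn_subrL n0.
  by apply: contra nd => d; rewrite -(subnK (ltnW nm)) dvdn_addr.
by rewrite mE dvdnn in nd.
Qed.

(** * The character sum of the Chebyshev polynomial *)

Local Notation phi := (map_poly intr (Chebyshev l) : {poly L}).

(** A square root u of [a] satisfies u^(p^m) = u a^((p^m - 1) / 2), so it lies in
    the field with p^m elements when [a] is 0 or its quadratic symbol is 1. *)
Lemma count_sqrt m a : (0 < m)%N -> a \in subF p L m ->
  (count (fun x => x ^+ 2 == a) (subF p L m))%:R = 1 + mu4 (a ^+ (quart m * 2)).
Proof.
move=> m0 am; have [u uE] := sqrt_exists a.
have um := subF_uniq charL m0.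
have cE x : (x ^+ 2 == a) = (x == u) || (x == - u) by rewrite -uE eqf_sqr.
rewrite (eq_count cE) {cE}; case: (eqVneq u 0) uE => [->|u0] uE.
  rewrite oppr0 (eq_count (a2 := pred1 0)) => [|x]; last exact: orbb.
  rewrite count_uniq_mem // -{1}(rmorph0 emb) fp_subF // -uE expr0n /=.
  by rewrite expr0n muln_eq0 orbF eqn0Ngt quart_gt0 // mu4_0 addr0.
have uNu : u != - u.
  by rewrite -subr_eq0 opprK -mulr2n -mulr_natr mulf_neq0.
rewrite -[count _ _]/(count (predU (pred1 u) (pred1 (- u))) _).
have -> : count (predU (pred1 u) (pred1 (- u))) (subF p L m) =
    ((u \in subF p L m) + (- u \in subF p L m))%N.
  rewrite -!count_uniq_mem // -[RHS]count_predUI.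
  rewrite [X in (_ + X)%N](eq_count (a2 := pred0)) ?count_pred0 ?addn0 // => x /=.
  by apply/negP=> /andP[/eqP -> /eqP E]; case/eqP: uNu.
have -> : (- u \in subF p L m) = (u \in subF p L m).
  by rewrite !mem_subF // (exppN charL) eqr_opp.
have E : u ^+ (p ^ m) = a ^+ (quart m * 2) * u.
  rewrite -uE -exprM; have -> : (2 * (quart m * 2) = (p ^ m).-1)%N by rewrite -quart4; lia.
  by rewrite -exprSr prednK // expn_gt0 prime_gt0.
rewrite mem_subF // E -[X in _ == X]mul1r (inj_eq (mulIf u0)).
have /eqP : (a ^+ (quart m * 2)) ^+ 2 = 1 ^+ 2.
  rewrite -exprM -mulnA quart4 expr1n subF_expr1 //.
  by rewrite -uE expf_neq0.
rewrite eqf_sqr => /orP[] /eqP ->; rewrite ?eqxx ?mu4_1 ?(mu4_N1 _ two0) //.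
by rewrite (negPf (neg1_neq1 two0)) subrr.
Qed.

Lemma powsum_even m : (0 < m)%N -> ~~ odd m ->
  powsum m = \sum_(z <- subF p L m) mu4 ((z * h^^.[z] ^+ 2) ^+ quart m).
Proof.
move=> m0 me; rewrite /powsum big_seq [RHS]big_seq; apply: eq_bigr => z zm.
rewrite Psi_normpoly // -signr_odd oddM (negPf me) expr0 mu4_1 mul1r //.
Qed.

Definition chebsum m := \sum_(x <- subF p L m) mu4 (phi.[x] ^+ (quart m * 2)).

Lemma chebyshev_subF m x : (0 < m)%N -> x \in subF p L m -> phi.[x] \in subF p L m.
Proof.
move=> m0 xm; rewrite chebyshev_hpoly subF_mul // horner_subF //.
by rewrite expr2 subF_mul.
Qed.

(** As phi(x) = x h(x^2), the summand is the quartic symbol g of z h(z)^2 at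
    z = x^2. The number of x with square z is 1 plus the quadratic symbol of z,
    and g times this symbol is g^3, the complex conjugate of g. *)
Lemma chebsum_powsum m : (0 < m)%N -> ~~ odd m ->
  chebsum m = powsum m + (powsum m)^*.
Proof.
move=> m0 me; pose t z := (z * h^^.[z] ^+ 2) ^+ quart m.
have t4 z : z \in subF p L m -> in_mu4 (t z).
  move=> zm; apply: in_mu4_quart => //.
  by rewrite subF_mul ?[_ ^+ 2]expr2 ?subF_mul ?horner_subF.
have step : chebsum m = \sum_(z <- subF p L m)
    mu4 (t z) * (count (fun x => x ^+ 2 == z) (subF p L m))%:R.
  transitivity (\sum_(x <- subF p L m) \sum_(z <- subF p L m) (x ^+ 2 == z)%:R * mu4 (t z)).
    rewrite /chebsum big_seq [RHS]big_seq; apply: eq_bigr => x xm.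
    have x2m : x ^+ 2 \in subF p L m by rewrite expr2 subF_mul.
    rewrite (bigD1_seq (x ^+ 2)) ?subF_uniq //= eqxx mul1r big1 ?addr0 => [|z zx].
      by rewrite /t chebyshev_hpoly mulnC exprM [(x * _) ^+ 2]exprMn.
    by rewrite eq_sym (negPf zx) mul0r.
  rewrite exchange_big /=; apply: eq_bigr => z _.
  rewrite -mulr_suml mulrC; congr (_ * _).
  by rewrite -sum1_count natr_sum [RHS]big_mkcond /=; apply: eq_bigr => x _; case: (_ == _).
rewrite step powsum_even // rmorph_sum -big_split /= big_seq [RHS]big_seq.
apply: eq_bigr => z zm; rewrite count_sqrt // mulrDr mulr1; congr (_ + _).
rewrite (mu4_conj hquart_sqr two0 (t4 z zm)) exprS -(muX 2 (t4 z zm)) /t.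
case: (eqVneq h^^.[z] 0) => [->|hz0].
  by rewrite expr0n mulr0 expr0n eqn0Ngt quart_gt0 //= mu4_0 !mul0r.
congr (_ * mu4 _); rewrite -[RHS]exprM exprMn -[X in _ = _ * X]exprM.
have -> : (2 * (quart m * 2) = (p ^ m).-1)%N by rewrite -quart4; lia.
by rewrite subF_expr1 ?horner_subF // mulr1.
Qed.

(** The Gauss sum is real, as its square is positive, and [eta hconst] = ['i]. *)
Lemma conj_moncoef_n : (moncoef n)^* = - moncoef n.
Proof.
have gauss_real : gauss^* = gauss.
  have := gauss_sqr; rewrite -(sqrtCK (p ^ n)%:R) => /eqP; rewrite eqf_sqr.
  have sqrt_real : (sqrtC (p ^ n)%:R)^* = sqrtC (p ^ n)%:R :> algC.
    by apply: conj_Creal; rewrite ger0_real // sqrtC_ge0 ler0n.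
  by case/orP=> /eqP ->; rewrite ?rmorphN /= sqrt_real.
by rewrite moncoef_n rmorphM /= conjCi gauss_real mulNr.
Qed.

Lemma n_mul_even k : ~~ odd (k * n).
Proof. by rewrite oddM (negPf n_even) andbF. Qed.

Lemma chebsum_multiple k :
  chebsum (k.+1 * n) = (-1) ^+ k * n%:R * moncoef n ^+ k.+1 * (1 + (-1) ^+ k.+1).
Proof.
rewrite chebsum_powsum ?n_mul_even ?muln_gt0 ?n0 // powsum_multiple.
rewrite !rmorphM !rmorphXn /= rmorphN rmorph1 rmorph_nat conj_moncoef_n.
by rewrite [X in _ + _ * X]exprNn; ring.
Qed.

Lemma chebsum_odd_multiple k : odd k -> chebsum (k * n) = 0.
Proof.
case: k => // k ok; rewrite chebsum_multiple -[(-1) ^+ k.+1]signr_odd ok expr1.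
by rewrite subrr mulr0.
Qed.

Lemma chebsum_even_multiple b : (0 < b)%N ->
  chebsum (b * 2 * n) = (-1) ^+ b.+1 * (l.-1 * p ^ (b * n))%:R.
Proof.
case: b => // b _; have -> : (b.+1 * 2 = (b * 2).+2)%N by lia.
rewrite chebsum_multiple -[(-1) ^+ (b * 2).+2]signr_odd -[(-1) ^+ (b * 2).+1]signr_odd.
rewrite /= muln2 odd_double /= expr0 expr1.
have -> : (b.*2.+2 = 2 * b.+1)%N by lia.
rewrite exprM moncoef_n_sqr [(- _%:R) ^+ _]exprNn -natrX -expnM [(n * _)%N]mulnC.
have -> : l.-1 = (n * 2)%N by rewrite {1}l_eq /= muln2.
by rewrite !natrM !exprS; ring.
Qed.

Lemma chebsum_maximal a : (0 < a)%N ->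
  chebsum (2 * a) = (l.-1 * p ^ a)%:R <->
  exists b, [/\ (0 < b)%N, odd b & a = (b * n)%N].
Proof.
move=> a0.
have nz : (l.-1 * p ^ a)%:R != 0 :> algC.
  have lp : (0 < l.-1)%N by rewrite l_eq /= double_gt0.
  by rewrite pnatr_eq0 -lt0n muln_gt0 lp expn_gt0 prime_gt0.
split=> [E|[b [b0 ob ->]]]; last first.
  by rewrite mulnA (mulnC 2) chebsum_even_multiple // -signr_odd /= ob mul1r.
have /dvdnP[k kE] : (n %| 2 * a)%N.
  apply: contraTT nz => nd; rewrite negbK -E chebsum_powsum ?muln_gt0 ?a0 ?oddM //.
  by rewrite powsum_nonmultiple ?muln_gt0 ?a0 // conjC0 addr0.
have ek : ~~ odd k.
  by apply: contraNN nz => ok; rewrite -E kE chebsum_odd_multiple.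
have kb : k = (k./2 * 2)%N by rewrite muln2 -[LHS]odd_double_half (negPf ek).
have aE : a = (k./2 * n)%N by move: kE; rewrite {1}kb; lia.
have b0 : (0 < k./2)%N by move: a0; rewrite {1}aE; case: (k./2).
exists (k./2); split=> //; apply: contraT => ob.
have := E; rewrite kE {1}kb chebsum_even_multiple // -signr_odd /= ob expr1 -aE mulN1r.
move/eqP; rewrite eq_sym -addr_eq0 -mulr2n mulrn_eq0 /= => nz'.
by case/negP: nz.
Qed.

Lemma card_affine (F : finFieldType) (e : {rmorphism F -> L}) (f : {poly F}) m :
  (0 < m)%N -> #|F| = (p ^ m)%N -> map_poly e f = phi ->
  (\sum_(x : F) #|[set y : F | y ^+ 2 == f.[x]]|)%:R = (p ^ m)%:R + chebsum m :> algC.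
Proof.
move=> m0 cF fE; rewrite natr_sum.
transitivity (\sum_(x <- subF p L m) (1 + mu4 (phi.[x] ^+ (quart m * 2)))); last first.
  by rewrite big_split /= big_const_seq count_predT iter_addr addr0 size_subF.
transitivity (\sum_(x <- subF p L m)
    (count (fun y => y ^+ 2 == phi.[x]) (subF p L m))%:R : algC); last first.
  rewrite big_seq [RHS]big_seq; apply: eq_bigr => x xm.
  by rewrite count_sqrt ?chebyshev_subF.
rewrite -(sum_embed charL e _ m0 cF); apply: eq_bigr => x _; congr (_%:R).
rewrite -sum1_count big_mkcond /= -(sum_embed charL e _ m0 cF) -big_mkcond /= -sum1dep_card.
apply: eq_bigl => y; rewrite -fE horner_map -rmorphXn /=.
by rewrite (inj_eq (fmorph_inj e)).
Qed.

End LFunction.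

(** * The points of a hyperelliptic curve with one point at infinity *)

Section PointCount.

Variables (F : finFieldType) (f : {poly F}) (d : nat).
Hypotheses (size_f : size f = d.+1) (d_odd : odd d).

Let g := hyp_genus f.

Lemma genus_odd : (2 * g + 2 = d.+1)%N.
Proof. by rewrite /g /hyp_genus size_f /=; move: d_odd; lia. Qed.

Definition wscale (c : F) (P : F * F * F) : F * F * F :=
  let: (X, Y, Z) := P in (c * X, c ^+ g.+1 * Y, c * Z).

Lemma wscaleA b c P : wscale b (wscale c P) = wscale (b * c) P.
Proof. by case: P => [[X Y] Z] /=; rewrite !mulrA exprMn. Qed.

Lemma wscale1 P : wscale 1 P = P.
Proof. by case: P => [[X Y] Z] /=; rewrite expr1n !mul1r. Qed.

Lemma mem_orbit P Q : reflect (exists2 c, c != 0 & Q = wscale c P) (Q \in weighted_orbit f P).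
Proof.
case: P => [[X Y] Z]; apply: (iffP imsetP) => [[c]|[c cn0 ->]]; rewrite ?inE.
  by exists c.
by exists c; rewrite ?inE.
Qed.

Lemma orbit_self P : P \in weighted_orbit f P.
Proof. by apply/mem_orbit; exists 1; rewrite ?oner_eq0 // wscale1. Qed.

Lemma orbit_scale c P : c != 0 -> weighted_orbit f (wscale c P) = weighted_orbit f P.
Proof.
move=> cn0; apply/setP=> Q; apply/mem_orbit/mem_orbit => -[b b0 ->].
  by exists (b * c); rewrite ?mulf_neq0 ?wscaleA.
by exists (b / c); rewrite ?mulf_neq0 ?invr_eq0 // wscaleA mulfVK.
Qed.

Lemma on_hyp_coneE X Y : on_hyp_cone f (X, Y, 1) = (Y ^+ 2 == f.[X]).
Proof.
rewrite /on_hyp_cone xpair_eqE oner_eq0 andbF /= horner_coef; congr (_ == _).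
by apply: eq_bigr => i _; rewrite expr1n mulr1.
Qed.

(** The degree of [f] being odd, it is smaller than 2 g + 2, so every term of the
    equation contains Z. *)
Lemma on_hyp_cone_infty X Y : on_hyp_cone f (X, Y, 0) = (X != 0) && (Y == 0).
Proof.
rewrite /on_hyp_cone xpair_eqE eqxx andbT big1 ?sqrf_eq0 // => i _.
rewrite -/g genus_odd expr0n subn_eq0 leqNgt.
by have := ltn_ord i; rewrite {2}size_f => ->; rewrite mulr0.
Qed.

Lemma on_hyp_cone_scale c P : c != 0 -> on_hyp_cone f (wscale c P) = on_hyp_cone f P.
Proof.
case: P => [[X Y] Z] cn0; rewrite /on_hyp_cone /= !xpair_eqE !mulf_eq0 (negPf cn0) /=.
congr (_ && _).
have -> : \sum_(i < size f) f`_i * (c * X) ^+ i * (c * Z) ^+ (2 * hyp_genus f + 2 - i) =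
    c ^+ (d.+1) * \sum_(i < size f) f`_i * X ^+ i * Z ^+ (2 * hyp_genus f + 2 - i).
  rewrite mulr_sumr; apply: eq_bigr => i _; rewrite -/g genus_odd.
  have le : (i <= d.+1)%N by rewrite ltnW // -size_f.
  by rewrite !exprMn -{3}(subnKC le) exprD; ring.
rewrite exprMn -exprM -/g; have -> : (g.+1 * 2 = d.+1)%N by rewrite -genus_odd; lia.
by rewrite (inj_eq (mulfI _)) // expf_neq0.
Qed.

(** Each orbit with Z <> 0 has a unique point with Z = 1, and the points with
    Z = 0 form one orbit. *)
Lemma card_hyp_points :
  #|hyp_points f| = (1 + \sum_(x : F) #|[set y : F | y ^+ 2 == f.[x]]|)%N.
Proof.
pose A := [set P : F * F | P.2 ^+ 2 == f.[P.1]].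
pose aff (P : F * F) := weighted_orbit f (P.1, P.2, 1).
have -> : hyp_points f = weighted_orbit f (1, 0, 0) |: (aff @: A).
  apply/setP=> O; apply/imsetP/setU1P => [[[[X Y] Z]]|].
    rewrite inE; have [->|Z0] := eqVneq Z 0.
      rewrite on_hyp_cone_infty => /andP[X0 /eqP ->] ->; left.
      rewrite -(orbit_scale (1, 0, 0) X0) /= !mulr0 mulr1 //.
    have E : (X, Y, Z) = wscale Z (X / Z, Y / Z ^+ g.+1, 1).
      by rewrite /= mulr1 !(mulrC _ (_ / _)) !mulfVK ?expf_neq0.
    rewrite E on_hyp_cone_scale // orbit_scale // on_hyp_coneE => h ->; right.
    by apply/imsetP; exists (X / Z, Y / Z ^+ g.+1); rewrite ?inE.
  case=> [->|/imsetP[[x y]]].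
    by exists (1, 0, 0); rewrite // inE on_hyp_cone_infty oner_eq0 eqxx.
  by rewrite inE /= => h ->; exists (x, y, 1); rewrite // inE on_hyp_coneE.
rewrite cardsU1 card_in_imset; last first.
  move=> [x y] [x' y'] _ _ E; have := orbit_self (x, y, 1).
  rewrite -[weighted_orbit _ _]/(aff (x, y)) E => /mem_orbit[c _ /= [-> ->]].
  by rewrite mulr1 => <-; rewrite expr1n !mul1r.
congr (_ + _)%N.
  case: imsetP => // -[[x y] _ E]; have := orbit_self (x, y, 1).
  rewrite -[weighted_orbit _ _]/(aff (x, y)) -E => /mem_orbit[c _ /= [_ _ /eqP]].
  by rewrite mulr0 oner_eq0.
under eq_bigr => x _ do rewrite -sum1dep_card.
by rewrite pair_big_dep /= -sum1dep_card.
Qed.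

End PointCount.

(** * Maximality *)

Local Close Scope ring_scope.
Unset Implicit Arguments.

Theorem theorem3p4p1 (l p : nat) (l_prime : prime l) (p_prime : prime p)
    (l_neq_p : l <> p) (l_mod4 : l = 1 %[mod 4]) (p_mod4 : p = 1 %[mod 4])
    (p_primitive : primitive_root_mod p l)
    (a : nat) (a_gt0 : 0 < a)
    (F : finFieldType) (iota : {rmorphism 'F_p -> F})
    (card_F : #|F| = (p ^ a) ^ 2) :
  hyp_maximal (map_poly iota (chebyshev_mod p l)) (p ^ a) <->
  exists b : nat, [/\ 0 < b, odd b & a = b * ((l - 1) %/ 2)].
Proof.
have [L [e _]] := countable_algebraic_closure F.
pose emb : {rmorphism 'F_p -> L} := e \o iota.
have charL : (p \in [pchar L])%R by apply: (rmorph_pchar emb); exact: pchar_Fp.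
have p_prim := primitive_root_modP (prime_gt0 p_prime) l_prime p_primitive.
have [theta thetaP] : exists theta : L, (l.-primitive_root theta)%R.
  exact: (theta_exists charL).
have [i i2] := sqrt_exists (-1 : L)%R.
have max := chebsum_maximal charL emb l_prime l_neq_p l_mod4 p_mod4 p_prim thetaP i2 a_gt0.
set f := map_poly iota _.
have fE : map_poly e f = map_poly intr (Chebyshev l).
  by rewrite /f /chebyshev_mod -!map_poly_comp; apply: eq_map_poly => z /=; rewrite !rmorph_int.
have genus_f : hyp_genus f = (l - 1) %/ 2 by rewrite hyp_genus_chebyshev ?prime_gt0.
have size_f : size f = l.+1.
  rewrite -(size_map_poly e) fE; have [mC sC] := Chebyshev_monic (prime_gt0 l_prime).
  by rewrite size_map_poly_id0 // (monicP mC) rmorph1 oner_neq0.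
have l_odd : odd l by move: l_mod4; lia.
have nE : ((l - 1) %/ 2 = l.-1./2) by rewrite subn1 divn2.
have card_F' : #|F| = p ^ (2 * a) by rewrite card_F mulnC expnM.
have a2 : 0 < 2 * a by rewrite muln_gt0.
have pts := card_affine charL emb l_prime l_neq_p l_mod4 p_mod4 p_prim thetaP i2 a2 card_F' fE.
rewrite nE -max /hyp_maximal genus_f nE (card_hyp_points size_f l_odd).
set N := \sum_x _ in pts *.
have dE : l.-1 = 2 * l.-1./2 by move: l_odd; lia.
have key : (N = p ^ (2 * a) + l.-1 * p ^ a) <->
    chebsum l emb theta i (2 * a) = ((l.-1 * p ^ a)%:R)%R.
  split=> [NE|cE]; first by move: pts; rewrite NE natrD => /addrI.
  by apply/eqP; rewrite -(eqr_nat algC) pts cE -natrD.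
rewrite -key; have -> : (p ^ a) ^ 2 = p ^ (2 * a) by rewrite mulnC expnM.
by rewrite -dE; split=> ?; lia.
Qed.
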